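(* For any $p>1$, $R>0$ and $r>0$ there exists a constant $C>0$ such that for every connected set $K\subset B(0,R)\subset\mathbb{R}^N$, $$\int_{K_r}|u|^p\,dx\le C\int_{K_r}|\nabla u|^p\,dx\qquad\text{for all } u\in W^{1,p}(K_r)\text{ with }\int_{K_r}u(x)\,dx=0,$$ where $K_r=\{x\in\mathbb{R}^N:\ d(x,K)<r\}$. In particular $C$ is independent of the choice of $K$.
   Context: $B(0,R)$ is the open Euclidean ball of radius $R$ centred at $0$ in $\mathbb{R}^N$, $d$ is Euclidean distance, and the dimension $N$ is fixed. Connected sets are nonempty. *)

(* Defs.v *)
From HB Require Import structures.
From mathcomp Require Import all_boot all_order all_algebra.
From mathcomp Require Import all_classical all_reals all_analysis.

Set Implicit Arguments.
Unset Strict Implicit.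
Unset Printing Implicit Defensive.

Import Order.TTheory GRing.Theory Num.Theory.
Import numFieldNormedType.Exports.

Local Open Scope classical_set_scope.
Local Open Scope ring_scope.

(** R^N is ['rV[R]_N].  The library gives it the topology of the sup norm, which
    is the usual one; distances below are nevertheless Euclidean. *)

Section Euclidean.
Context {R : realType} {N : nat}.
Implicit Types (x y : 'rV[R]_N) (K : set 'rV[R]_N).

Definition enorm x : R := Num.sqrt (\sum_(i < N) x 0 i ^+ 2).

Definition eball x (r : R) : set 'rV[R]_N := [set y | enorm (x - y) < r].

(* A genuine infimum only for nonempty [K]: the library has [inf set0 = 0]. *)
Definition dist_set x K : R := inf [set enorm (x - y) | y in K].

Definition tube K (r : R) : set 'rV[R]_N := [set x | dist_set x K < r].

End Euclidean.

(** R^N carries the product sigma-algebra, that is, the Borel one.  As with the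
    library's [lebesgue_measure], Lebesgue measure is taken on Borel sets only;
    every Lebesgue measurable function is equal almost everywhere to a Borel
    one. *)

Definition rV_display : measure_display -> measure_display.
Proof. exact. Qed.

Section rV_measurable.
Context {R : realType} {N : nat}.

Definition coord (i : 'I_N) (x : 'rV[R]_N) : measurableTypeR R := x 0 i.

Let rV_set0 : g_sigma_preimage coord set0.
Proof. exact: sigma_algebra0. Qed.

Let rV_setC A : g_sigma_preimage coord A -> g_sigma_preimage coord (~` A).
Proof. exact: sigma_algebraC. Qed.

Let rV_bigcup (F : (set 'rV[R]_N)^nat) :
  (forall i, g_sigma_preimage coord (F i)) ->
  g_sigma_preimage coord (\bigcup_i F i).
Proof. exact: sigma_algebra_bigcup. Qed.

HB.instance Definition _ := @isMeasurable.Build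
  (rV_display (measure_tuple_display default_measure_display))
  'rV[R]_N (g_sigma_preimage coord) rV_set0 rV_setC rV_bigcup.

Lemma measurable_coord i : measurable_fun [set: 'rV[R]_N] (coord i).
Proof.
move=> _ Y mY; rewrite setTI; apply: sub_sigma_algebra => /=.
rewrite -bigcup_seq/=; exists i => /=; first by rewrite mem_index_enum.
by exists Y => //; rewrite setTI.
Qed.

Lemma measurable_fun_rV d (T : measurableType d) (f : T -> 'rV[R]_N) :
  (forall i, measurable_fun [set: T] (coord i \o f)) ->
  measurable_fun [set: T] f.
Proof.
move=> mf.
have sub : g_sigma_preimage (fun i => coord i \o f) `<=` measurable.
  apply: smallest_sub; first exact: sigma_algebra_measurable.
  rewrite -bigcup_seq => A [i _ [B mB <-]]; exact: mf.
move=> _ A mA; apply: sub; rewrite g_sigma_preimage_comp.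
by exists A.
Qed.

End rV_measurable.

Section lebesgue_measure_rV.
Context {R : realType}.

Definition rV_cons {n} (xy : measurableTypeR R * 'rV[R]_n) : 'rV[R]_n.+1 :=
  row_mx (xy.1%:M : 'rV_1) xy.2.

Definition rV_uncons {n} (z : 'rV[R]_n.+1) : measurableTypeR R * 'rV[R]_n :=
  (z 0 0, rsubmx (z : 'rV_(1 + n))).

Lemma rV_consK {n} : cancel (@rV_cons n) rV_uncons.
Proof.
move=> [x y]; rewrite /rV_cons /rV_uncons row_mxKr.
by congr pair; rewrite mxE; case: splitP => // j _; rewrite ord1 !mxE eqxx.
Qed.

Lemma measurable_rV_cons n : measurable_fun setT (@rV_cons n).
Proof.
apply: measurable_fun_rV => i; case: (unliftP ord0 i) => [j ->|->].
- rewrite (_ : _ \o _ = coord j \o snd).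
    by apply: measurableT_comp; [exact: measurable_coord|exact: measurable_snd].
  apply/funext => -[x y] /=; rewrite /coord /rV_cons.
  have -> : lift ord0 j = rshift 1 j by exact: ord_inj.
  by rewrite (@row_mxEr _ 1 1 n).
- rewrite (_ : _ \o _ = fst); first exact: measurable_fst.
  apply/funext => -[x y] /=; rewrite /coord /rV_cons.
  have -> : ord0 = lshift n (ord0 : 'I_1) :> 'I_n.+1 by exact: ord_inj.
  by rewrite (@row_mxEl _ 1 1 n) mxE eqxx.
Qed.

Lemma measurable_rV_uncons n : measurable_fun setT (@rV_uncons n).
Proof.
apply/measurable_fun_pairP; split.
  exact: (measurable_coord ord0).
apply: measurable_fun_rV => i.
rewrite (_ : _ \o _ = coord (rshift 1 i)); first exact: measurable_coord.
by apply/funext => z; rewrite /coord /= mxE.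
Qed.

Section step.
Context {n : nat} (m : {sigma_finite_measure set 'rV[R]_n -> \bar R}).
Local Open Scope ereal_scope.

Definition lebesgue_rVS : set 'rV[R]_n.+1 -> \bar R :=
  pushforward (@lebesgue_measure R \x m) (@rV_cons n).

Let lebesgue_rVS0 : lebesgue_rVS set0 = 0.
Proof. by rewrite /lebesgue_rVS /pushforward preimage_set0 measure0. Qed.

Let lebesgue_rVS_ge0 A : 0 <= lebesgue_rVS A.
Proof. exact: (@measure_ge0 _ _ _ (@lebesgue_measure R \x m)). Qed.

Let lebesgue_rVS_sigma_additive : semi_sigma_additive lebesgue_rVS.
Proof.
exact: (@measure_semi_sigma_additive _ _ _
  (@measure_function_pushforward__canonical__measure_function_Measure _ _ _ _ _
    (@lebesgue_measure R \x m) _ (@measurable_rV_cons n))).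
Qed.

HB.instance Definition _ := isMeasure.Build _ _ _ lebesgue_rVS
  lebesgue_rVS0 lebesgue_rVS_ge0 lebesgue_rVS_sigma_additive.

Lemma lebesgue_rVS_X A B : measurable A -> measurable B ->
  lebesgue_rVS (rV_uncons @^-1` (A `*` B)) = lebesgue_measure A * m B.
Proof.
move=> mA mB; rewrite /lebesgue_rVS /pushforward -comp_preimage.
rewrite (_ : _ \o _ = id); first by rewrite preimage_id product_measure1E.
by apply/funext => xy /=; rewrite rV_consK.
Qed.

Let lebesgue_rVS_sigma_finite : sigma_finite setT lebesgue_rVS.
Proof.
have /sigma_finiteP[F [TF ndF Foo]] := sigma_finiteT (@lebesgue_measure R).
have /sigma_finiteP[G [TG ndG Goo]] := sigma_finiteT m.
exists (fun k => rV_uncons @^-1` (F k `*` G k)).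
  apply/seteqP; split => // z _.
  have : setT (rV_uncons z).1 by []. rewrite TF => -[i _ Fi].
  have : setT (rV_uncons z).2 by []. rewrite TG => -[j _ Gj].
  exists (maxn i j) => //; split.
  - by move: Fi; exact/subsetPset/ndF/leq_maxl.
  - by move: Gj; exact/subsetPset/ndG/leq_maxr.
move=> k; have [mF Fk] := Foo k; have [mG Gk] := Goo k; split.
  rewrite -[X in measurable X]setTI; apply: measurable_rV_uncons => //.
  exact: measurableX.
by rewrite lebesgue_rVS_X// lte_mul_pinfty// ge0_fin_numE.
Qed.

HB.instance Definition _ := Measure_isSigmaFinite.Build _ _ _ lebesgue_rVS
  lebesgue_rVS_sigma_finite.

End step.

(* Characterised by its values on boxes, see [lebesgue_rV_box]. *)
Fixpoint lebesgue_rV (n : nat) : {sigma_finite_measure set 'rV[R]_n -> \bar R} :=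
  match n with
  | 0 => dirac (0 : 'rV[R]_0)
  | n.+1 => lebesgue_rVS (lebesgue_rV n)
  end.

Lemma lebesgue_rV_box n (a b : 'rV[R]_n) : (forall i, a 0 i <= b 0 i) ->
  lebesgue_rV n [set x | forall i, a 0 i <= x 0 i <= b 0 i] =
  (\prod_(i < n) (b 0 i - a 0 i))%:E.
Proof.
elim: n a b => [|n IHn] a b ab /=.
  by rewrite big_ord0 diracE mem_set//= => -[].
set a' := rsubmx (a : 'rV_(1 + n)); set b' := rsubmx (b : 'rV_(1 + n)).
have E (c : 'rV[R]_n.+1) i : rsubmx (c : 'rV_(1 + n)) 0 i = c 0 (lift ord0 i).
  by rewrite mxE; congr (c _ _); exact: ord_inj.
rewrite [X in lebesgue_rVS _ X](_ : _ = rV_uncons @^-1` (`[a 0 0, b 0 0]%classic `*`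
    [set x : 'rV[R]_n | forall i, a' 0 i <= x 0 i <= b' 0 i])); last first.
  apply/seteqP; split => x /=.
    move=> H; split; first by rewrite in_itv/= H.
    by move=> i; rewrite !E H.
  rewrite in_itv/= => -[x0 H] i.
  by case: (unliftP ord0 i) => [j ->|->//]; rewrite -!E; exact: H.
rewrite lebesgue_rVS_X; [|exact: measurable_itv|].
  rewrite IHn; last by move=> i; rewrite !E.
  rewrite lebesgue_measure_itv/= lte_fin big_ord_recl EFinM.
  have := ab 0; rewrite le_eqVlt => /predU1P[->|->].
    by rewrite ltxx subrr !mul0e.
  by rewrite -EFinB; congr (_ * _)%E; congr EFin; apply: eq_bigr => i _; rewrite !E.
rewrite [X in measurable X](_ : _ =
    \bigcap_(i in [set: 'I_n]) (coord i @^-1` `[a' 0 i, b' 0 i]%classic)).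
  apply: fin_bigcap_measurable => // i _.
  by rewrite -[X in measurable X]setTI; exact: measurable_coord.
apply/seteqP; split => x /= H i; first by rewrite /= in_itv/= H.
by have := H i I; rewrite /= in_itv.
Qed.

End lebesgue_measure_rV.

Section Sobolev.
Context {R : realType} {N : nat}.
Implicit Types (Om : set 'rV[R]_N) (f u v phi : 'rV[R]_N -> R) (p : R).

Local Notation mu := (@lebesgue_rV R N).

Definition partial (i : 'I_N) f : 'rV[R]_N -> R := 'D_(delta_mx 0 i) f.

Definition iter_partial (s : seq 'I_N) f : 'rV[R]_N -> R := foldr partial f s.

(* ['D_v f] is a junk value where the derivative does not exist, hence the
   derivability condition. *)
Definition smooth f := forall s : seq 'I_N,
  continuous (iter_partial s f) /\
  forall (i : 'I_N) (x : 'rV[R]_N), derivable (iter_partial s f) x (delta_mx 0 i).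

Definition tsupport f : set 'rV[R]_N := closure [set x | f x != 0].

Definition test_function Om phi :=
  [/\ smooth phi, compact (tsupport phi) & tsupport phi `<=` Om].

(* Functions on [Om] are total functions whose values outside [Om] are
   irrelevant. *)
Definition in_Lp p Om u :=
  measurable_fun Om u /\ (\int[mu]_(x in Om) (`|u x| `^ p)%:E < +oo)%E.

Definition weak_partial Om (i : 'I_N) u v := forall phi, test_function Om phi ->
  (\int[mu]_(x in Om) (u x * partial i phi x)%:E =
   - \int[mu]_(x in Om) (v x * phi x)%:E)%E.

(* [u] belongs to W^{1,p}(Om) and [Du] is (a representative of) its gradient. *)
Definition W1p_gradient p Om u (Du : 'rV[R]_N -> 'rV[R]_N) :=
  [/\ in_Lp p Om u,
      forall i, in_Lp p Om (fun x => Du x 0 i) &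
      forall i, weak_partial Om i u (fun x => Du x 0 i)].

End Sobolev.

(* Main.v *)
Require Import Defs.
From mathcomp Require Import all_boot all_order all_algebra.
From mathcomp Require Import all_classical all_reals all_analysis.
From mathcomp Require Import measurable_realfun ring lra.

(** The inequality is proved for the energy of pairs
    [osc p u A B = \int_(x in A) \int_(z in B) `|u x - u z| ^ p] rather than for
    the deviation of [u] from its mean.  When [u] has mean zero over the tube
    [Om], the value [u x] is the mean of the differences [u x - u z], and Jensen's
    inequality bounds the measure of [Om] times the integral of [`|u| ^ p] by
    [osc p u Om Om] ([mean_zero_osc]).  The measure of [Om] is at least that of a
    ball of radius [r / 2].

    Locally, suppose that any point of [A] and any point of [B] lie in a common
    ball of the tube ([local_osc]).  Balls being convex, the segment from [x] to
    [z] stays in the tube, and for almost all such segments [u z - u x] is the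
    average along the segment of the scalar product of the gradient with
    [z - x] ([weak_line]).  Jensen's inequality then bounds [`|u x - u z| ^ p] by
    an average of the [p]-th power of the norm of the gradient at the points
    [x + s *: (z - x)].  For [s <= 1 / 2] this point is the image of [x] under a
    dilation of ratio at least [1 / 2], for [s >= 1 / 2] it is such an image of
    [z]; the change of variables costs at most [2 ^ N] and bounds [osc p u A B]
    by a multiple of the energy of the gradient that depends only on [p], [r], [N]
    and a bound on the measures of the two sets ([integral_pairs_le]).

    The identity along segments comes from the weak gradient by duality.  Products
    over the coordinates of a smooth function of one variable give test functions
    that approximate the indicators of boxes ([test_function_tbump],
    [cvg_tbump]).  Tested against such a bump, a difference of [u] becomes a
    difference of the bump, to which the classical fundamental theorem of calculus
    applies ([weak_line_tbump]).  An integrable function that is orthogonal to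
    these bumps vanishes almost everywhere ([fundamental_lemma]).

    Globally, the ball of radius [rho] is cut into finitely many cells of diameter
    less than [r / 8] ([grid_cells]).  As [K] is connected, any two cells that meet
    [K] are joined by a chain of cells meeting [K] in which the gaps are less than
    [r / 8] ([connected_adjacent]), and the chain may be assumed to visit each cell
    at most once.  The inequality [osc_triangle] passes from one ball of radius
    [r / 2] to the next with a factor that depends on the measure of such a ball
    and on an upper bound for the measure of the tube.  The length of the chains
    is bounded by the number of cells, whence a constant independent of [K]
    ([osc_tube]). *)

Set Implicit Arguments.
Unset Strict Implicit.
Unset Printing Implicit Defensive.

Import Order.TTheory GRing.Theory Num.Theory.
Import numFieldNormedType.Exports.

Local Open Scope classical_set_scope.
Local Open Scope ring_scope.

(** * Euclidean geometry of the space of row vectors *)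

Section geometry.
Context {R : realType} {N : nat}.
Implicit Types (x y z : 'rV[R]_N) (K : set 'rV[R]_N).

Lemma sumsq_ge0 x : 0 <= \sum_(i < N) x 0 i ^+ 2.
Proof. by apply: sumr_ge0 => i _; exact: sqr_ge0. Qed.

Lemma enorm_ge0 x : 0 <= enorm x.
Proof. exact: sqrtr_ge0. Qed.

Lemma enorm_le x (a : R) : 0 <= a -> (enorm x <= a) = (\sum_(i < N) x 0 i ^+ 2 <= a ^+ 2).
Proof. by move=> a0; rewrite /enorm -{1}(ger0_norm a0) -sqrtr_sqr ler_sqrt ?sqr_ge0. Qed.

Lemma coord_le_enorm x i : `|x 0 i| <= enorm x.
Proof.
rewrite -sqrtr_sqr /enorm ler_sqrt ?sumsq_ge0// (bigD1 i)//= lerDl.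
by apply: sumr_ge0 => j _; exact: sqr_ge0.
Qed.

Lemma enormN x : enorm (- x) = enorm x.
Proof. by rewrite /enorm; congr Num.sqrt; apply: eq_bigr => i _; rewrite mxE sqrrN. Qed.

Lemma enorm_dC x y : enorm (x - y) = enorm (y - x).
Proof. by rewrite -opprB enormN. Qed.

Lemma enorm0 : enorm (0 : 'rV[R]_N) = 0.
Proof. by rewrite /enorm big1 ?sqrtr0// => i _; rewrite mxE expr0n. Qed.

Lemma enormZ (c : R) x : 0 <= c -> enorm (c *: x) = c * enorm x.
Proof.
move=> c0; rewrite /enorm -{2}(ger0_norm c0) -sqrtr_sqr -sqrtrM ?sqr_ge0//.
by congr Num.sqrt; rewrite mulr_sumr; apply: eq_bigr => i _; rewrite mxE exprMn.
Qed.

(** Weighting the inequality between the geometric and the arithmetic mean by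
    the two norms replaces the Cauchy-Schwarz inequality. *)
Lemma enorm_triangle x y : enorm (x + y) <= enorm x + enorm y.
Proof.
apply/ler_addgt0Pr => e e0.
set a := enorm x + e / 2; set b := enorm y + e / 2.
have a0 : 0 < a by have := enorm_ge0 x; rewrite /a; lra.
have b0 : 0 < b by have := enorm_ge0 y; rewrite /b; lra.
have -> : enorm x + enorm y + e = a + b by rewrite /a /b; lra.
have xa : \sum_(i < N) x 0 i ^+ 2 <= a ^+ 2 by rewrite -enorm_le ?ltW// /a; lra.
have yb : \sum_(i < N) y 0 i ^+ 2 <= b ^+ 2 by rewrite -enorm_le ?ltW// /b; lra.
rewrite enorm_le; last by lra.
apply: (@le_trans _ _ (\sum_(i < N) ((1 + b / a) * x 0 i ^+ 2 + (1 + a / b) * y 0 i ^+ 2))).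
  apply: ler_sum => i _; rewrite mxE -subr_ge0.
  rewrite [X in 0 <= X](_ : _ = (b / a) * (x 0 i - a / b * y 0 i) ^+ 2).
    by rewrite mulr_ge0 ?sqr_ge0// ltW// divr_gt0.
  by field; rewrite !gt_eqF.
rewrite big_split/= -!mulr_sumr.
apply: (@le_trans _ _ ((1 + b / a) * a ^+ 2 + (1 + a / b) * b ^+ 2)).
  have ? : 0 < 1 + b / a by rewrite addr_gt0// divr_gt0.
  have ? : 0 < 1 + a / b by rewrite addr_gt0// divr_gt0.
  by apply: lerD; rewrite ler_pM2l.
by rewrite le_eqVlt; apply/orP; left; apply/eqP; field; rewrite !gt_eqF.
Qed.

Lemma enorm_dist x y z : enorm (x - z) <= enorm (x - y) + enorm (y - z).
Proof. by rewrite -[x - z](subrKA y); exact: enorm_triangle. Qed.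

Lemma eball_convex c (r : R) x y (s : R) : 0 <= s <= 1 ->
  eball c r x -> eball c r y -> eball c r (x + s *: (y - x)).
Proof.
move=> /andP[s0 s1]; rewrite /eball/= => cx cy.
have -> : c - (x + s *: (y - x)) = (1 - s) *: (c - x) + s *: (c - y).
  by apply/rowP => i; rewrite !mxE; ring.
apply: le_lt_trans (enorm_triangle _ _) _.
rewrite !enormZ ?subr_ge0//.
have [->|s0'] := eqVneq s 0; first by rewrite subr0 mul1r mul0r addr0.
have sp : 0 < s by rewrite lt_neqAle eq_sym s0' s0.
have h1 : (1 - s) * enorm (c - x) <= (1 - s) * r by rewrite ler_wpM2l ?subr_ge0// ltW.
have h2 : s * enorm (c - y) < s * r by rewrite ltr_pM2l.
by apply: lt_le_trans (ler_ltD h1 h2) _; lra.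
Qed.

Lemma continuous_sum (T : topologicalType) (I : Type) (r : seq I) (F : I -> T -> R) :
  (forall i, continuous (F i)) -> continuous (fun t => \sum_(i <- r) F i t).
Proof.
by move=> cF; apply: (@continuous_big R I +%R 0 xpredT _ T r F) => //; exact: add_continuous.
Qed.

Lemma enorm_continuous : continuous (@enorm R N).
Proof.
move=> x; rewrite /enorm.
apply: (@continuous_comp _ _ _ (fun x : 'rV[R]_N => \sum_(i < N) x 0 i ^+ 2) Num.sqrt);
  last exact: sqrt_continuous.
apply: continuous_sum => i z.
by apply: (@continuous_comp _ _ _ (fun t : 'rV[R]_N => t 0 i) (fun t => t ^+ 2)); [exact: coord_continuous|exact: exprn_continuous].
Qed.

Lemma open_eball x (r : R) : open (eball x r).
Proof.
rewrite (_ : eball x r = (fun y => enorm (x - y)) @^-1` [set t | t < r]) //.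
apply: open_comp; last exact: open_lt.
move=> y _; apply: (@continuous_comp _ _ _ (fun y => x - y) enorm); last exact: enorm_continuous.
by apply: (@continuousB _ _ _ (fun=> x) id) => //; exact: cst_continuous.
Qed.

(** The infimum in the distance to a set need not be attained, but the strict
    inequality passes to some member of the set. *)
Lemma tubeE K (r : R) : K !=set0 -> tube K r = \bigcup_(y in K) eball y r.
Proof.
move=> [k Kk]; rewrite /tube /dist_set; apply/seteqP; split => x /=.
  move=> /inf_lt[]; last by move=> _ [y Ky <-] xy; exists y => //; rewrite /eball/= enorm_dC.
  by exists (enorm (x - k)), k.
move=> [y Ky]; rewrite /eball/= enorm_dC; apply: le_lt_trans; apply: ge_inf; last by exists y.
by exists 0 => _ [z _ <-]; exact: enorm_ge0.
Qed.

Definition obox (a b : 'rV[R]_N) : set 'rV[R]_N := [set x | forall i, a 0 i < x 0 i < b 0 i].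
Definition cbox (a b : 'rV[R]_N) : set 'rV[R]_N := [set x | forall i, a 0 i <= x 0 i <= b 0 i].

Lemma measurable_coord_pred (P : 'I_N -> set R) : (forall i, measurable (P i : set (measurableTypeR R))) ->
  measurable [set x : 'rV[R]_N | forall i, P i (x 0 i)].
Proof.
move=> mP; rewrite (_ : [set x : 'rV[R]_N | _] = \bigcap_(i in [set: 'I_N]) (Defs.coord i @^-1` (P i))).
  apply: fin_bigcap_measurable => // i _.
  by rewrite -[X in measurable X]setTI; exact: measurable_coord.
by apply/seteqP; split => x /= H i; [move=> _; exact: H|exact: H].
Qed.

Lemma measurable_obox a b : measurable (obox a b).
Proof.
rewrite (_ : obox a b = [set x : 'rV[R]_N | forall i, `]a 0 i, b 0 i[%classic (x 0 i)]).
  by apply: (measurable_coord_pred (P := fun i => `]a 0 i, b 0 i[%classic)) => i; exact: measurable_itv.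
by apply/seteqP; split => x /= + i => /(_ i); rewrite in_itv.
Qed.

Lemma measurable_cbox a b : measurable (cbox a b).
Proof.
rewrite (_ : cbox a b = [set x : 'rV[R]_N | forall i, `[a 0 i, b 0 i]%classic (x 0 i)]).
  by apply: (measurable_coord_pred (P := fun i => `[a 0 i, b 0 i]%classic)) => i; exact: measurable_itv.
by apply/seteqP; split => x /= + i => /(_ i); rewrite in_itv.
Qed.

Lemma compact_cbox a b : compact (cbox a b).
Proof.
rewrite (_ : cbox a b = [set x : 'rV[R]_N | forall i, `[a 0 i, b 0 i]%classic (x 0 i)]).
  by apply: (@rV_compact _ _ (fun i => `[a 0 i, b 0 i]%classic)) => i; exact: segment_compact.
by apply/seteqP; split => x /= + i => /(_ i); rewrite in_itv.
Qed.

Definition ratv (q : 'rV[rat]_N) : 'rV[R]_N := \row_i ratr (q 0 i).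

(** There are only countably many rational boxes.  This makes open sets
    measurable, and lets a property be checked almost everywhere on an open set
    by checking it on the boxes that it contains. *)
Lemma open_rat_box (O : set 'rV[R]_N) x : open O -> O x ->
  exists q : 'rV[rat]_N * 'rV[rat]_N,
    obox (ratv q.1) (ratv q.2) x /\ cbox (ratv q.1) (ratv q.2) `<=` O.
Proof.
move=> oO Ox; have /nbhs_ballP[e /= e0 eO] : nbhs x O by exact: open_nbhs_nbhs.
have H i : exists q : rat * rat, x 0 i - e < ratr q.1 < x 0 i /\ x 0 i < ratr q.2 < x 0 i + e.
  have h1 : x 0 i - e < x 0 i by lra.
  have h2 : x 0 i < x 0 i + e by lra.
  have [q1 /[!in_itv]/= q1P] := rat_in_itvoo h1.
  have [q2 /[!in_itv]/= q2P] := rat_in_itvoo h2.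
  by exists (q1, q2).
pose q i := projT1 (cid (H i)).
have qP i := projT2 (cid (H i)).
exists (\row_i (q i).1, \row_i (q i).2); split => /= [i|y yP].
  by rewrite !mxE; have [/andP[_ ->] /andP[-> _]] := qP i.
apply: eO; rewrite /ball/= /mx_ball; split => // i j; rewrite ord1 /ball/=.
have := yP j; rewrite !mxE; have [] := qP j; rewrite -/(q j).
by rewrite ltr_distlC; lra.
Qed.

Lemma measurable_open (O : set 'rV[R]_N) : open O -> measurable O.
Proof.
move=> oO.
rewrite (_ : O = \bigcup_(q in [set q : 'rV[rat]_N * 'rV[rat]_N | cbox (ratv q.1) (ratv q.2) `<=` O])
    obox (ratv q.1) (ratv q.2)).
  rewrite bigcup_mkcond; apply: countable_bigcupT_measurable => // q.
  by case: ifP => _ //; exact: measurable_obox.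
apply/seteqP; split => x.
  by move=> Ox; have [q [xq qO]] := open_rat_box oO Ox; exists q.
by move=> [q /= qO xq]; apply: qO => i; have /andP[/ltW-> /ltW->] := xq i.
Qed.

Local Notation mu := (@lebesgue_rV R N).

Lemma lebesgue_eball_gt0 (c : 'rV[R]_N) (r : R) : 0 < r -> (0 < mu (eball c r))%E.
Proof.
move=> r0; have [q [cq qB]] : exists q : 'rV[rat]_N * 'rV[rat]_N,
    obox (ratv q.1) (ratv q.2) c /\ cbox (ratv q.1) (ratv q.2) `<=` eball c r.
  by apply: open_rat_box; [exact: open_eball|rewrite /eball/= subrr enorm0].
apply: (@lt_le_trans _ _ (mu (cbox (ratv q.1) (ratv q.2)))); last first.
  by apply: le_measure => //; rewrite inE; [exact: measurable_cbox|apply: measurable_open; exact: open_eball].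
have qq i : ratv q.1 0 i < ratv q.2 0 i by have /andP[] := cq i; exact: lt_trans.
rewrite lebesgue_rV_box; last by move=> i; exact: ltW.
by rewrite lte_fin; apply: prodr_gt0 => i _; rewrite subr_gt0.
Qed.

Lemma lebesgue_eball_le (c : 'rV[R]_N) (r : R) : 0 < r -> (mu (eball c r) <= ((2 * r) ^+ N)%:E)%E.
Proof.
move=> r0; pose v : 'rV[R]_N := const_mx r.
apply: (@le_trans _ _ (mu (cbox (c - v) (c + v)))).
  apply: le_measure; rewrite ?inE; [apply: measurable_open; exact: open_eball|exact: measurable_cbox|].
  move=> x cx i; rewrite !mxE; have := le_lt_trans (coord_le_enorm (c - x) i) cx.
  by rewrite !mxE ltr_norml; lra.
rewrite lebesgue_rV_box; last by move=> i; rewrite !mxE; lra.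
rewrite lee_fin; under eq_bigr do rewrite !mxE.
rewrite (eq_bigr (fun=> 2 * r)); last by move=> i _; ring.
by rewrite prodr_const card_ord.
Qed.

End geometry.

(** * Dilations and translations of Lebesgue measure *)

Section dilation.
Context {R : realType}.
Local Open Scope ereal_scope.

Local Notation lam := (@lebesgue_measure R).

Let dil (a b : R) : measurableTypeR R -> measurableTypeR R := fun x => (a * x + b)%R.

Let mdil a b : measurable_fun setT (dil a b).
Proof. by apply: measurable_funD => //; apply: measurable_funM. Qed.

(** Both sides are measures in the set, and they agree on half-open intervals. *)
Lemma lebesgue_dilation (a b : R) (A : set (measurableTypeR R)) : (0 < a)%R -> measurable A ->
  lam A = a%:E * lam (dil a b @^-1` A).
Proof.
move=> a0 mA; pose k : {nonneg R} := NngNum (ltW a0).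
pose nu : {measure set (measurableTypeR R) -> \bar R} :=
  mscale k (@measure_function_pushforward__canonical__measure_function_Measure _ _ _ _ _
    lam _ (@mdil a b)).
rewrite (@lebesgue_measure_unique R nu) // => _ [[c d]] _ <-.
rewrite /nu/= /mscale/= /pushforward/=.
rewrite (_ : dil a b @^-1` _ = `]((c - b) / a)%R, ((d - b) / a)%R]%classic); last first.
  apply/seteqP; split => x; rewrite /dil/= !in_itv/= ltr_pdivrMr// ler_pdivlMr//;
    by rewrite ltrBlDr lerBrDr (mulrC x).
rewrite !lebesgue_measure_itv/= !lte_fin ltr_pM2r ?invr_gt0// ltrD2r.
case: ifP => _; last by rewrite mule0.
by rewrite -!EFinB -EFinM; congr EFin; field; rewrite gt_eqF.
Qed.

Lemma integral_dilation1 (a b : R) (f : measurableTypeR R -> \bar R) : (0 < a)%R ->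
  measurable_fun setT f -> (forall x, 0 <= f x) ->
  \int[lam]_x f x = a%:E * \int[lam]_x f (a * x + b)%R.
Proof.
move=> a0 mf f0; pose k : {nonneg R} := NngNum (ltW a0).
pose nu0 : {measure set (measurableTypeR R) -> \bar R} :=
  @measure_function_pushforward__canonical__measure_function_Measure _ _ _ _ _
    lam _ (@mdil a b).
pose nu : {measure set (measurableTypeR R) -> \bar R} := mscale k nu0.
transitivity (\int[nu]_x f x).
  by apply: eq_measure_integral => A mA _; exact: lebesgue_dilation.
rewrite ge0_integral_mscale//; congr (_ * _).
by rewrite ge0_integral_pushforward.
Qed.

Lemma measurable_affine n (a : R) (b : 'rV[R]_n) :
  measurable_fun setT (fun x : 'rV[R]_n => (a *: x + b)%R).
Proof.
apply: measurable_fun_rV => i.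
rewrite (_ : _ \o _ = (fun x : 'rV[R]_n => (a * Defs.coord i x + b 0 i)%R)); last first.
  by apply/funext => x; rewrite /Defs.coord/= !mxE.
by apply: measurable_funD => //; apply: measurable_funM => //; exact: measurable_coord.
Qed.

Lemma integral_rVS n (f : 'rV[R]_n.+1 -> \bar R) :
  measurable_fun setT f -> (forall x, 0 <= f x) ->
  \int[lebesgue_rV n.+1]_x f x = \int[lam]_x \int[lebesgue_rV n]_y f (rV_cons (x, y)).
Proof.
move=> mf f0; rewrite [LHS]/= /lebesgue_rVS.
rewrite (@ge0_integral_pushforward _ _ _ _ _ _ (@measurable_rV_cons R n) (lam \x lebesgue_rV n) setT f)//.
rewrite preimage_setT fubini_tonelli1//; last by move=> z; exact: f0.
by apply: measurableT_comp => //; exact: measurable_rV_cons.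
Qed.

Lemma rV_cons0 n x (y : 'rV[R]_n) : rV_cons (x, y) 0%R ord0 = x.
Proof.
rewrite /rV_cons/=; have -> : ord0 = lshift n (ord0 : 'I_1) :> 'I_n.+1 by exact: ord_inj.
by rewrite (@row_mxEl _ 1 1 n) mxE eqxx.
Qed.

Lemma rV_consS n x (y : 'rV[R]_n) j : rV_cons (x, y) 0%R (lift ord0 j) = y 0%R j.
Proof.
rewrite /rV_cons/=; have -> : lift ord0 j = rshift 1 j by exact: ord_inj.
by rewrite (@row_mxEr _ 1 1 n).
Qed.

(** A dilation acts on each coordinate separately, so that the case of the line
    applies to one coordinate after the other. *)
Lemma integral_dilation n (a : R) (b : 'rV[R]_n) (f : 'rV[R]_n -> \bar R) : (0 < a)%R ->
  measurable_fun setT f -> (forall x, 0 <= f x) ->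
  \int[lebesgue_rV n]_x f x = (a ^+ n)%:E * \int[lebesgue_rV n]_x f (a *: x + b)%R.
Proof.
move=> a0; elim: n b f => [|n IHn] b f mf f0.
  by rewrite expr0 mul1e; apply: eq_integral => x _; congr f; apply/rowP => -[].
rewrite !integral_rVS//; last by apply: measurableT_comp => //; exact: measurable_affine.
have mfc : measurable_fun setT (f \o @rV_cons R n).
  by apply: measurableT_comp => //; exact: measurable_rV_cons.
pose b' := rsubmx (b : 'rV_(1 + n)).
have E x y : (a *: rV_cons (x, y) + b)%R = rV_cons ((a * x + b 0 0)%R, (a *: y + b')%R).
  apply/rowP => i; rewrite 2![in LHS]mxE; case: (unliftP ord0 i) => [j ->|->].
    rewrite !rV_consS !mxE; congr (_ + b _ _)%R; exact: ord_inj.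
  by rewrite !rV_cons0.
under [X in _ = _ * X]eq_integral do under eq_integral do rewrite E.
rewrite (@integral_dilation1 a (b 0 0)%R _ a0); last 2 first.
- have f0' z : 0 <= (f \o @rV_cons R n) z by exact: f0.
  exact: (measurable_fun_fubini_tonelli_F _ mfc f0').
- by move=> x; exact: integral_ge0.
rewrite exprS EFinM -muleA; congr (_ * _).
rewrite -ge0_integralZl//; last 3 first.
- apply: (@measurable_fun_fubini_tonelli_F _ _ _ _ _ (lebesgue_rV n)
    (fun z : measurableTypeR R * 'rV[R]_n => f (rV_cons ((a * z.1 + b 0 0)%R, (a *: z.2 + b')%R)))) => //.
  rewrite (_ : (fun z => _) = (f \o @rV_cons R n) \o
      (fun z : measurableTypeR R * 'rV[R]_n => ((a * z.1 + b 0 0)%R, (a *: z.2 + b')%R))) //.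
  apply: measurableT_comp => //; apply/measurable_fun_pairP; split => /=.
    exact: (measurableT_comp (@mdil a (b 0 0)%R) measurable_fst).
  exact: (measurableT_comp (measurable_affine a b') measurable_snd).
- by move=> x _; exact: integral_ge0.
- by rewrite lee_fin exprn_ge0// ltW.
apply: eq_integral => x _; apply: (IHn b' (fun y => f (rV_cons (_, y)))) => //.
exact: (measurableT_comp mfc (pair1_measurable _)).
Qed.

Lemma integral_translation n (b : 'rV[R]_n) (f : 'rV[R]_n -> \bar R) : 
  measurable_fun setT f -> (forall x, 0 <= f x) ->
  \int[lebesgue_rV n]_x f (x + b)%R = \int[lebesgue_rV n]_x f x.
Proof.
move=> mf f0; rewrite (@integral_dilation _ 1 b f)// expr1n mul1e.
by under [RHS]eq_integral do rewrite scale1r.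
Qed.

End dilation.

(** * Smooth bumps over boxes *)

Section flat.
Context {R : realType}.

(** The derivatives of [flat 0], the function exp(-1/t) continued by zero to the
    left, are linear combinations of the [flat k]. *)
Definition flat (k : nat) (t : R) : R :=
  if 0 < t then t^-1 ^+ k * expR (- t^-1) else 0.

Lemma flat_ge0 k t : 0 <= flat k t.
Proof. by rewrite /flat; case: ifP => // t0; rewrite mulr_ge0 ?expR_ge0// exprn_ge0// invr_ge0 ltW. Qed.

Lemma flat0_le1 t : flat 0 t <= 1.
Proof. by rewrite /flat; case: ifP => // t0; rewrite expr0 mul1r -expR0 ler_expR oppr_le0 invr_ge0 ltW. Qed.

(** The exponential beats every power. *)
Lemma flat_le k t : flat k t <= (k.+2)`!%:R * t ^+ 2.
Proof.
rewrite /flat; case: ifP => [t0|_]; last by rewrite mulr_ge0 ?sqr_ge0.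
have := @expR_ge1Dxn R t^-1 k.+1; rewrite invr_ge0 ltW// => /(_ isT) h.
have h1 : t^-1 ^+ k.+2 / k.+2`!%:R <= expR t^-1 by apply: le_trans h; rewrite lerDr.
have f0 : 0 < k.+2`!%:R :> R by rewrite ltr0n fact_gt0.
have tk0 : 0 < t^-1 ^+ k.+2 by rewrite exprn_gt0// invr_gt0.
rewrite expRN; apply: (@le_trans _ _ (t^-1 ^+ k * (k.+2`!%:R / t^-1 ^+ k.+2))).
  rewrite ler_wpM2l ?exprn_ge0 ?invr_ge0 ?(ltW t0)//.
  by rewrite -[leRHS]invf_div lef_pV2 ?posrE ?expR_gt0// divr_gt0.
rewrite le_eqVlt; apply/orP; left; apply/eqP.
rewrite -addn2 exprD; field; rewrite !gt_eqF//=.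
by rewrite exprn_gt0// invr_gt0.
Qed.

Lemma flat_at0 k : flat k 0 = 0.
Proof. by rewrite /flat ltxx. Qed.

Lemma flatS k t : flat k t = flat k.+1 t * t.
Proof.
rewrite /flat; case: ifP => t0; last by rewrite mul0r.
by rewrite exprS; field; rewrite gt_eqF.
Qed.

Lemma is_derive_flat (k : nat) (t : R) : is_derive t 1 (flat k) (flat k.+2 t - k%:R * flat k.+1 t).
Proof.
have [t0|t0|->] := ltgtP t 0.
- rewrite (_ : _ - _ = 0); last by rewrite /flat !ltNge (ltW t0)/= mulr0 subr0.
  apply: (near_eq_is_derive _ (is_derive_cst (0:R) (t:R) 1)).
  near=> s; have s0 : s < 0 by near: s; exact: lt_nbhsl.
  by rewrite /flat ltNge (ltW s0).
- have dV : is_derive t 1 (fun s : R => s^-1) (- t^-1 ^+ 2).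
    have tn0 : id t != 0 by rewrite gt_eqF.
    apply: DeriveDef; first by apply: (derivableV tn0); exact: derivable_id.
    by rewrite (@deriveV _ _ id t 1 tn0) ?derive_id; [rewrite /GRing.scale/= mulr1 exprVn|exact: derivable_id].
  have dE : is_derive t 1 (fun s : R => expR (- s^-1)) (t^-1 ^+ 2 * expR (- t^-1)).
    have H := is_derive1_comp (is_derive_expR ((- (fun s : R => s^-1)) t)) (is_deriveN dV).
    by apply: (is_derive_eq H); rewrite opprK mulrC.
  have dX : is_derive t 1 (fun s : R => s^-1 ^+ k) ((k%:R * t^-1 ^+ k.-1) * (- t^-1 ^+ 2)).
    rewrite (_ : (fun s : R => _) = (fun s : R => s^-1) ^+ k); last first.
      by apply/funext => s; rewrite exprfctE.
    exact: is_deriveX.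
  apply: (near_eq_is_derive _ (is_derive_eq (is_deriveM dX dE) _)).
    near=> s; have s0 : 0 < s by near: s; exact: lt_nbhsr.
    by rewrite /flat s0.
  rewrite /flat t0.
  rewrite /GRing.scale/=; case: k {dX} => [|k]; first by rewrite !mul0r mulr0 addr0 subr0 expr0 mul1r.
  by rewrite [k.+1.-1]/= !exprS; ring.
(* At the origin the difference quotient of [flat k] is [flat k.+1]. *)
- apply/is_derive1_caratheodory; exists (flat k.+1); split.
  + by move=> z; rewrite subr0 -flatS /flat ltxx subr0.
  + have -> : {for 0, continuous (flat k.+1)} = (flat k.+1 z @[z --> 0] --> (0:R)).
      by rewrite /prop_for /continuous_at flat_at0.
    apply: (@squeeze_cvgr _ _ _ _ (cst 0) (fun t => k.+3`!%:R * t ^+ 2)).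
    * by near=> z; rewrite flat_ge0 flat_le.
    * exact: cvg_cst.
    * rewrite [X in _ --> X](_ : 0 = k.+3`!%:R * (0:R) ^+ 2); last by rewrite expr0n mulr0.
      by apply: cvgM; [exact: cvg_cst|exact: exprn_continuous].
  + by rewrite /flat ltxx mulr0 subr0.
Unshelve. all: by end_near. Qed.

(** The algebra generated by the [flat k] in affine arguments is stable under
    differentiation; hence all its members are smooth. *)
Inductive flat_alg : (R -> R) -> Prop :=
| Flat k a b : flat_alg (fun t => flat k (a * t + b))
| FlatC c : flat_alg (fun=> c)
| FlatD f g : flat_alg f -> flat_alg g -> flat_alg (f + g)
| FlatM f g : flat_alg f -> flat_alg g -> flat_alg (f * g).

Lemma flat_alg_derive f : flat_alg f ->
  exists2 g, flat_alg g & forall t : R, is_derive t 1 f (g t).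
Proof.
elim=> [k a b|c|f1 f2 _ [g1 G1 H1] _ [g2 G2 H2]|f1 f2 F1 [g1 G1 H1] F2 [g2 G2 H2]].
- exists ((fun=> a) * ((fun t => flat k.+2 (a * t + b)) + (fun=> - k%:R) * (fun t => flat k.+1 (a * t + b)))).
    by apply: FlatM; [exact: FlatC|apply: FlatD; [exact: Flat|apply: FlatM; [exact: FlatC|exact: Flat]]].
  move=> t.
  have dA : is_derive t 1 (fun t : R => a * t + b) a.
    have H := is_deriveD (is_deriveZ a (is_derive_id t 1)) (is_derive_cst b t 1).
    by apply: (is_derive_eq H); rewrite addr0 /GRing.scale/= mulr1.
  have H := is_derive1_comp (is_derive_flat k ((fun s => a * s + b) t)) dA.
  by apply: (is_derive_eq H); rewrite !fctE mulNr mulrC.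
- by exists (fun=> 0); [exact: FlatC|move=> t; exact: is_derive_cst].
- exists (g1 + g2); first exact: FlatD.
  by move=> t; exact: is_deriveD.
- exists (f1 * g2 + f2 * g1); first by apply: FlatD; apply: FlatM.
  by move=> t; have := is_deriveM (H1 t) (H2 t).
Qed.

Lemma flat_alg_derivable f t : flat_alg f -> derivable f t 1.
Proof. by move=> /flat_alg_derive[g _ fg]; have [] := fg t. Qed.

Lemma flat_alg_derive1 f : flat_alg f -> flat_alg (derive1 f).
Proof.
move=> /flat_alg_derive[g Gg fg]; rewrite (_ : (derive1 f) = g)//.
by apply/funext => t; rewrite derive1E; have [_ ->] := fg t.
Qed.

Lemma flat_alg_is_derive1 f (t : R) : flat_alg f -> is_derive t 1 f (derive1 f t).
Proof. by move=> ff; rewrite derive1E; apply/derivableP; exact: flat_alg_derivable. Qed.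

Lemma flat_alg_continuous f : flat_alg f -> continuous f.
Proof.
move=> ff t; apply: differentiable_continuous; apply/derivable1_diffP.
exact: flat_alg_derivable.
Qed.

End flat.

Section tensor.
Context {R : realType}.

Lemma is_derive_prod (I : eqType) (s : seq I) (f f' : I -> R -> R) (t : R) : uniq s ->
  (forall i, is_derive t 1 (f i) (f' i t)) ->
  is_derive t 1 (fun t => \prod_(i <- s) f i t)
    (\sum_(i <- s) \prod_(j <- s) (if j == i then f' j t else f j t)).
Proof.
move=> + df; elim: s => [_|a s IHs /=/andP[as_ us]].
  rewrite big_nil (_ : (fun t => _) = cst 1); first exact: is_derive_cst.
  by apply/funext => x; rewrite big_nil.
rewrite (_ : (fun t => _) = f a * (fun t => \prod_(i <- s) f i t)); last first.
  by apply/funext => x; rewrite big_cons.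
apply: (is_derive_eq (is_deriveM (df a) (IHs us))).
rewrite !big_cons/= eqxx /GRing.scale/= addrC mulrC; congr (_ * _ + _).
  apply: eq_big_seq => j js; case: eqP => // ja.
  by rewrite -ja js in as_.
rewrite mulr_sumr; apply: eq_big_seq => i is_; rewrite big_cons.
by case: eqP => // ai; rewrite -ai in is_; rewrite is_ in as_.
Qed.

Context {N : nat}.
Implicit Types (B : 'I_N -> R -> R) (x y v : 'rV[R]_N).

(** Products of functions of one coordinate each: a partial derivative only
    replaces one of the factors, so that iterated ones keep this form. *)
Definition tensor B x : R := \prod_(i < N) B i (x 0 i).

Definition tensor_d i B : 'rV[R]_N -> R :=
  tensor (fun j => if j == i then derive1 (B j) else B j).

(** The chain rule along a line is proved directly, from the product rule in one
    variable; the directional derivatives are its case [s = 0]. *)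
Lemma tensor_line B y v (s : R) : (forall i, flat_alg (B i)) ->
  is_derive s 1 (fun s => tensor B (s *: v + y)) (\sum_(i < N) v 0 i * tensor_d i B (s *: v + y)).
Proof.
move=> FB.
have dB i : is_derive s 1 (fun t : R => B i (t * v 0 i + y 0 i))
    ((fun t => v 0 i * derive1 (B i) (t * v 0 i + y 0 i)) s).
  have dA : is_derive s 1 (fun t : R => t * v 0 i + y 0 i) (v 0 i).
    have H := is_deriveD (is_deriveZ (v 0 i) (is_derive_id s 1)) (is_derive_cst (y 0 i) s 1).
    rewrite (_ : (fun t : R => _) = (v 0 i \*: id + cst (y 0 i))); last first.
      by apply/funext => t; rewrite !fctE mulrC.
    by apply: (is_derive_eq H); rewrite addr0 /GRing.scale/= mulr1.
  have H := is_derive1_comp (flat_alg_is_derive1 ((fun t : R => t * v 0 i + y 0 i) s) (FB i)) dA.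
  by apply: (is_derive_eq H); rewrite mulrC.
have H := @is_derive_prod 'I_N (index_enum 'I_N) _
  (fun i t => v 0 i * derive1 (B i) (t * v 0 i + y 0 i)) s (index_enum_uniq _) dB.
rewrite (_ : (fun s => _) = (fun t => \prod_(i <- index_enum 'I_N) B i (t * v 0 i + y 0 i))).
  apply: (is_derive_eq H); apply: eq_bigr => i _.
  rewrite /tensor_d /tensor (bigD1 i)//= eqxx [in RHS](bigD1 i)//= eqxx !mxE mulrA; congr (_ * _).
  by apply: eq_bigr => j /negbTE ji; rewrite ji !mxE.
by apply/funext => t; apply: eq_bigr => i _; rewrite !mxE.
Qed.

Lemma is_derive_tensor B y v : (forall i, flat_alg (B i)) ->
  is_derive y v (tensor B) (\sum_(i < N) v 0 i * tensor_d i B y).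
Proof.
move=> FB; have [H1 H2] := tensor_line y v 0 FB.
split; first exact/derivable1P.
rewrite scale0r add0r in H2; rewrite -H2 /derive; set g1 := fun h => h^-1 *: _; set g2 := fun h => h^-1 *: _.
suff -> : g1 = g2 by [].
by apply/funext => h; rewrite /g1 /g2/= scale0r add0r addr0 /GRing.scale/= mulr1.
Qed.

Lemma partial_tensor B i : (forall i, flat_alg (B i)) ->
  partial i (tensor B) = tensor_d i B.
Proof.
move=> FB; apply/funext => y; rewrite /partial.
have [_ ->] := is_derive_tensor y (delta_mx 0 i) FB.
rewrite (bigD1 i)//= mxE !eqxx mul1r big1 ?addr0// => j ji.
by rewrite mxE (negbTE ji) andbF mul0r.
Qed.

Lemma tensor_continuous B : (forall i, flat_alg (B i)) -> continuous (tensor B).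
Proof.
move=> FB; apply: (@continuous_big R 'I_N *%R 1 xpredT _ 'rV[R]_N _ (fun i x => B i (x 0 i))).
  exact: mul_continuous.
move=> i _ x; apply: (@continuous_comp _ _ _ (fun z : 'rV[R]_N => z 0 i) (B i)).
  exact: coord_continuous.
exact: flat_alg_continuous.
Qed.

Lemma tensor_d_flat i B : (forall i, flat_alg (B i)) ->
  forall j, flat_alg (if j == i then derive1 (B j) else B j).
Proof. by move=> FB j; case: eqP => // _; exact: flat_alg_derive1. Qed.

Lemma smooth_tensor B : (forall i, flat_alg (B i)) -> smooth (tensor B).
Proof.
move=> FB s; have [B' FB' ->] : exists2 B', (forall i, flat_alg (B' i)) &
    iter_partial s (tensor B) = tensor B'.
  elim: s => [|i s [B' FB' /= ->]]; first by exists B.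
  exists (fun j => if j == i then derive1 (B' j) else B' j); last exact: partial_tensor.
  exact: tensor_d_flat.
split; first exact: tensor_continuous.
by move=> i x; have [] := is_derive_tensor x (delta_mx 0 i) FB'.
Qed.

(** [bump1 k a b] is positive exactly on the interval from a to b, takes values
    in the unit interval and converges to its indicator as k grows. *)
Definition bump1 (k : nat) (a b t : R) : R := flat 0 (k.+1%:R * (t - a)) * flat 0 (k.+1%:R * (b - t)).

Lemma flat_alg_bump k a b : flat_alg (bump1 k a b).
Proof.
rewrite (_ : bump1 k a b = (fun t => flat 0 (k.+1%:R * t + (- k.+1%:R * a))) *
    (fun t => flat 0 ((- k.+1%:R) * t + (k.+1%:R * b)))).
  by apply: FlatM; exact: Flat.
by apply/funext => t; rewrite !fctE /bump1; congr (flat 0 _ * flat 0 _); ring.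
Qed.

Lemma bump_ge0 k a b t : 0 <= bump1 k a b t.
Proof. by rewrite mulr_ge0 ?flat_ge0. Qed.

Lemma bump_le1 k a b t : bump1 k a b t <= 1.
Proof. by rewrite mulr_ile1 ?flat_ge0 ?flat0_le1. Qed.

Lemma bump_out k a b t : ~~ (a < t < b) -> bump1 k a b t = 0.
Proof.
rewrite /bump1 /flat !pmulr_rgt0// !subr_gt0.
by case: (a < t) => /=; [case: (t < b) => //= _; rewrite mulr0|rewrite mul0r].
Qed.

Lemma cvg_bump a b t : bump1 k a b t @[k --> \oo] --> ((a < t < b)%R%:R : R).
Proof.
have [/andP[at_ tb]|abt] := boolP (a < t < b); last first.
  by under eq_cvg do rewrite bump_out//; exact: cvg_cst.
have H (c : R) : 0 < c -> flat 0 (k.+1%:R * c) @[k --> \oo] --> (1 : R).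
  move=> c0; rewrite (_ : (fun k => _) = (fun k : nat => expR (- (c^-1 * k.+1%:R^-1)))); last first.
    apply/funext => k; rewrite /flat pmulr_rgt0// c0 expr0 mul1r invfM; congr (expR (- _)); exact: mulrC.
  rewrite -[X in _ --> X]expR0; apply: continuous_cvg; first exact: continuous_expR.
  rewrite -[X in _ --> X]oppr0 -[X in _ --> - X](mulr0 c^-1).
  by apply: cvgN; apply: cvgM; [exact: cvg_cst|exact: cvg_harmonic].
rewrite /= -[X in _ --> X](mulr1 1); apply: cvgM; apply: H; lra.
Qed.

Definition tbump k (a b : 'rV[R]_N) : 'rV[R]_N -> R := tensor (fun i => bump1 k (a 0 i) (b 0 i)).

Lemma tbump_ge0 k a b x : 0 <= tbump k a b x.
Proof. by apply: prodr_ge0 => i _; exact: bump_ge0. Qed.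

Lemma tbump_le1 k a b x : tbump k a b x <= 1.
Proof. by apply: prodr_ile1 => i _; rewrite bump_ge0 bump_le1. Qed.

Lemma tbump_out k a b x : ~ obox a b x -> tbump k a b x = 0.
Proof.
move=> /existsNP[i /negP abx].
by rewrite /tbump /tensor (bigD1 i)//= bump_out// mul0r.
Qed.

Lemma cvg_tbump a b x : tbump k a b x @[k --> \oo] --> (\1_(obox a b) x : R).
Proof.
rewrite (_ : \1_(obox a b) x = \prod_(i < N) (a 0 i < x 0 i < b 0 i)%R%:R :> R).
  apply: (@cvg_big R 'I_N *%R 1 xpredT) => //; first exact: mul_continuous.
  by move=> i _; exact: cvg_bump.
rewrite indicE; have [|] := boolP (x \in _); rewrite ?inE ?notin_setE => abx.
  by rewrite big1// => i _; rewrite abx.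
by move/existsNP : abx => [i /negP/negbTE abx]; rewrite (bigD1 i)//= abx mul0r.
Qed.

Lemma test_function_tbump k a b (O : set 'rV[R]_N) : cbox a b `<=` O ->
  test_function O (tbump k a b).
Proof.
move=> abO.
have sub : tsupport (tbump k a b) `<=` cbox a b.
  rewrite /tsupport (closure_id (cbox a b)).1; last first.
    by apply: compact_closed; [exact: norm_hausdorff|exact: compact_cbox].
  apply: closureS => x /= /eqP; apply: contra_notP => abx.
  by apply: tbump_out; apply: contra_not abx => abx i; have /andP[/ltW-> /ltW->] := abx i.
split.
- by apply: smooth_tensor => i; exact: flat_alg_bump.
- apply: (subclosed_compact _ (@compact_cbox _ _ a b)) => //.
  exact: closed_closure.
- exact: subset_trans sub abO.
Qed.

End tensor.

(** * The fundamental lemma of the calculus of variations *)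

Section fundamental_lemma.
Context {R : realType} {N : nat}.
Local Notation mu := (@lebesgue_rV R N).
Implicit Types (O : set 'rV[R]_N) (a b : 'rV[R]_N).

Lemma continuous_measurable_rV (f : 'rV[R]_N -> R) : continuous f -> measurable_fun setT f.
Proof.
move=> /continuousP cf; apply: (measurability _ (RGenOpens.measurableE R)).
move=> _ [_ [x [y ->] <-]]; rewrite setTI; apply: measurable_open.
by apply: cf; exact: interval_open.
Qed.

Lemma measurable_tbump k a b : measurable_fun setT (tbump k a b).
Proof.
apply: continuous_measurable_rV; apply: tensor_continuous => i; exact: flat_alg_bump.
Qed.

(** Dominated convergence, with the absolute value of [f] as the dominating
    function. *)
Lemma integral_obox_eq0 (f : 'rV[R]_N -> R) a b :
  mu.-integrable setT (EFin \o f) ->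
  (forall k, \int[mu]_x (f x * tbump k a b x)%:E = 0)%E ->
  (\int[mu]_x (f x * \1_(obox a b) x)%:E = 0)%E.
Proof.
move=> fi H.
have mf : measurable_fun setT f by apply/measurable_EFinP; exact: measurable_int fi.
have mF k : measurable_fun setT (fun x => (f x * tbump k a b x)%:E).
  by apply/measurable_EFinP; apply: measurable_funM => //; exact: measurable_tbump.
have mG : measurable_fun setT (fun x => (f x * \1_(obox a b) x)%:E).
  by apply/measurable_EFinP; apply: measurable_funM => //; apply: measurable_indic; exact: measurable_obox.
have cvF : {ae mu, forall x, setT x -> (f x * tbump k a b x)%:E @[k --> \oo] --> (f x * \1_(obox a b) x)%:E}.
  apply: aeW => x _; apply: cvg_EFin; first by near=> k.
  by apply: cvgM; [exact: cvg_cst|exact: cvg_tbump].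
have bF : {ae mu, forall x k, setT x -> (`|(f x * tbump k a b x)%:E| <= (abse \o (EFin \o f)) x)%E}.
  apply: aeW => x k _ /=; rewrite lee_fin normrM ler_piMr// ger0_norm ?tbump_ge0//.
  exact: tbump_le1.
have [_ _] := dominated_convergence measurableT mF mG cvF (integrable_abse fi) bF.
rewrite (_ : [sequence _]_n = cst 0%E); last by apply/funext => k; exact: H.
by move=> /(cvg_unique _ (@cvg_cst _ _ _ _ _)) => <-.
Unshelve. all: by end_near. Qed.

(** Orthants that are unbounded above, with any set of constrained coordinates.
    They generate the Borel sets, are stable under intersection, and cut a box in
    a box. *)
Definition rays : set (set 'rV[R]_N) :=
  [set A | exists J : pred 'I_N, exists c : 'rV[R]_N, A = [set x : 'rV[R]_N | forall i, J i -> c 0 i < x 0 i]].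

Lemma measurable_rays : @measurable _ 'rV[R]_N = <<s rays >>.
Proof.
apply/seteqP; split; last first.
  apply: smallest_sub; first exact: sigma_algebra_measurable.
  move=> _ [J [c ->]].
  rewrite (_ : [set x : 'rV[R]_N | _] = [set x | forall i, (if J i then `]c 0 i, +oo[%classic else setT) (x 0 i)]).
    apply: (measurable_coord_pred (P := fun i => if J i then `]c 0 i, +oo[%classic else setT)) => i.
    by case: (J i) => //; exact: measurable_itv.
  apply/seteqP; split => x /= H i; first by case: ifP => // /H; rewrite /= in_itv/= andbT.
  by move=> Ji; have := H i; rewrite Ji/= in_itv/= andbT.
apply: smallest_sub; first exact: smallest_sigma_algebra.
move=> A; rewrite -bigcup_seq => -[i _ [B + <-]]; rewrite setTI.
have [S0 SC SU] := smallest_sigma_algebra setT rays.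
change ((@measurable _ (measurableTypeR R) B) -> (<<s rays >>) (Defs.coord i @^-1` B)).
suff : @measurable _ (measurableTypeR R) `<=` [set B | (<<s rays >>) (Defs.coord i @^-1` B)] by apply.
rewrite [X in X `<=` _](RGenOInfty.measurableE R).
apply: smallest_sub.
  split => /=.
  - by rewrite preimage_set0.
  - by move=> C SCi; rewrite setTD preimage_setC -setTD; exact: SC.
  - by move=> F SF; rewrite preimage_bigcup; exact: SU.
move=> _ [x ->] /=; apply: sub_sigma_algebra.
exists (pred1 i), (const_mx x); apply/seteqP; split => y /=; rewrite /Defs.coord/=.
  by rewrite in_itv/= andbT => xy j /eqP->; rewrite mxE.
by move=> /(_ i (eqxx _)); rewrite mxE in_itv/= andbT.
Qed.

Lemma setI_closed_rays : setI_closed rays.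
Proof.
move=> _ _ [J [c ->]] [J' [c' ->]].
exists (fun i => J i || J' i), (\row_i (if J i then if J' i then Num.max (c 0 i) (c' 0 i) else c 0 i else c' 0 i)).
apply/seteqP; split => x /=.
  move=> [H H'] i; rewrite mxE; have := H i; have := H' i.
  case: (J i); case: (J' i) => //.
  by move=> /(_ isT) h1 /(_ isT) h2; rewrite gt_max h1 h2.
move=> H; split => i Ji; have := H i; rewrite mxE Ji ?orbT => /(_ isT);
  by [case: (J' i); rewrite ?gt_max// => /andP[]|case: (J i); rewrite ?gt_max// => /andP[]].
Qed.

(** The bumps of a box converge to its indicator, so [f] has integral zero over
    every box in [O].  For a fixed box, the sets whose intersection with it
    carries integral zero form a Dynkin system, which contains the orthants
    [rays]; it therefore contains all Borel sets, and [f] vanishes almost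
    everywhere on the box. *)
Lemma fundamental_lemma (f : 'rV[R]_N -> R) O : open O ->
  mu.-integrable setT (EFin \o f) ->
  (forall k a b, cbox a b `<=` O -> \int[mu]_x (f x * tbump k a b x)%:E = 0)%E ->
  {ae mu, forall x, O x -> f x = 0}.
Proof.
move=> oO fi H.
have mf : measurable_fun setT f by apply/measurable_EFinP; exact: measurable_int fi.
have box a b : cbox a b `<=` O -> {ae mu, forall x, obox a b x -> f x = 0}.
  move=> abO.
  pose h x := (f x * \1_(obox a b) x)%:E.
  have hi : mu.-integrable setT h.
    apply: (le_integrable measurableT _ _ fi).
      apply/measurable_EFinP; apply: measurable_funM => //; apply: measurable_indic; exact: measurable_obox.
    by move=> x _ /=; rewrite lee_fin normrM indicE; case: (_ \in _); rewrite ?normr1 ?normr0 ?mulr1 ?mulr0.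
  have H0 E : measurable E -> (\int[mu]_(x in E) h x = 0)%E.
    move=> mE.
    apply: (dynkin_induction (P := fun E => (\int[mu]_(x in E) h x = 0)%E) measurable_rays
      setI_closed_rays) => //; last 3 first.
    - move=> S mS S0.
      have := @integral_setU _ _ _ mu S (~` S) h mS (measurableC mS).
      rewrite setUv => /(_ (measurable_int _ hi)); rewrite disj_set2E setICr eqxx => /(_ isT).
      by rewrite S0 add0e => <-; apply: integral_obox_eq0 => // k; exact: H.
    - move=> F mF tF F0; rewrite integral_bigcup//.
        by rewrite eseries0// => i _ _; exact: F0.
      by apply: integrableS hi => //; exact: bigcup_measurable.
    - by rewrite -measurable_rays.
    - by apply: integral_obox_eq0 => // k; exact: H.
    - move=> _ [J [c ->]].
      pose a' := \row_i (if J i then Num.max (a 0 i) (c 0 i) else a 0 i).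
      have aa' i : a 0 i <= a' 0 i by rewrite mxE; case: (J i) => //; rewrite le_max lexx.
      rewrite integral_mkcond (eq_integral (fun x => (f x * \1_(obox a' b) x)%:E)).
        apply: integral_obox_eq0 => // k; apply: H; apply: subset_trans abO => x xb i.
        by have /andP[h1 ->] := xb i; rewrite (le_trans (aa' i) h1).
      move=> x _; rewrite patchE /h.
      have xE : obox a' b x <-> (forall i, J i -> c 0 i < x 0 i) /\ obox a b x.
        split=> [xb|[xc xb] i].
          split=> i; last by have /andP[h1 ->] := xb i; rewrite (le_lt_trans (aa' i) h1).
          by move=> Ji; have := xb i; rewrite mxE Ji gt_max => /andP[/andP[]].
        by have /andP[h1 ->] := xb i; rewrite andbT mxE; case: ifP => // Ji; rewrite gt_max h1 xc.
      rewrite !indicE; case: ifPn; rewrite ?inE ?notin_setE => xc.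
        congr (f x * _%:R)%:E; congr (nat_of_bool _); apply/idP/idP; rewrite !inE => xb.
          by apply/xE.
        by case/xE : xb.
      have -> : (x \in obox a' b) = false by apply/negbTE; rewrite notin_setE => /xE[].
      by rewrite mulr0.
  have := @integral_ae_eq _ _ _ mu setT measurableT (cst 0%E) h hi.
  move=> /(_ (measurable_cst _)) H1.
  have {}H1 : ae_eq mu setT h (cst 0%E) by apply: H1 => E _ mE; rewrite H0// integral0.
  apply: filterS H1 => x /(_ I); rewrite /h => + xb.
  by rewrite indicE mem_set// mulr1 => -[].
(* The exceptional sets are collected over the countably many rational boxes. *)
pose F n := match @unpickle ('rV[rat]_N * 'rV[rat]_N)%type n with
  | Some q => if `[< cbox (@ratv R _ q.1) (ratv q.2) `<=` O >] then obox (ratv q.1) (ratv q.2) `&` [set x | f x != 0] else set0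
  | None => set0 end.
change (mu.-negligible (~` [set x | O x -> f x = 0])).
have nF : mu.-negligible (\bigcup_n F n).
  apply: negligible_bigcup => n; rewrite /F; case: unpickle => [q|]; last exact: negligible_set0.
  case: asboolP => [qO|_]; last exact: negligible_set0.
  apply: negligibleS (box _ _ qO) => x /= [qx /eqP fx]; exact/not_implyP.
apply: negligibleS nF => x /= /not_implyP[Ox fx].
have [q [xq qO]] := open_rat_box oO Ox.
by exists (pickle q) => //; rewrite /F pickleK; case: asboolP => // _; split => //; apply/eqP.
Qed.
End fundamental_lemma.

(** * Iterated real integrals and averages over the unit interval *)

Section real_fubini.
Context d1 d2 (T1 : measurableType d1) (T2 : measurableType d2) (R : realType).
Implicit Types (f : T1 * T2 -> R).

Lemma integrable_fine (m : {measure set T1 -> \bar R}) (F : T1 -> \bar R) :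
  m.-integrable setT F -> m.-integrable setT (fun x => (fine (F x))%:E).
Proof.
move=> Fi; apply: (le_integrable measurableT _ _ Fi).
  by apply/measurable_EFinP; apply: measurableT_comp => //; exact: measurable_int Fi.
by move=> x _; case: (F x) => //=; rewrite normr0 leey.
Qed.

Lemma integral_fine (m : {measure set T1 -> \bar R}) (F : T1 -> \bar R) :
  m.-integrable setT F -> (\int[m]_x (fine (F x))%:E = \int[m]_x F x)%E.
Proof.
move=> Fi; apply: ae_eq_integral => //.
- exact: measurable_int (integrable_fine Fi).
- exact: measurable_int Fi.
- have := integrable_ae measurableT Fi; apply: filterS => x /(_ I) Fx _.
  by rewrite fineK.
Qed.

Variables (m1 : {sigma_finite_measure set T1 -> \bar R}) (m2 : {sigma_finite_measure set T2 -> \bar R}).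

Lemma integrable_Rfubini1 f : (m1 \x m2)%E.-integrable setT (EFin \o f) ->
  m1.-integrable setT (fun x => (\int[m2]_y f (x, y))%:E).
Proof. by move=> fi; apply: (integrable_fine (integrable_fubini_F fi)). Qed.
End real_fubini.

Section real_fubini2.
Context d1 d2 (T1 : measurableType d1) (T2 : measurableType d2) (R : realType).
Variables (m1 : {sigma_finite_measure set T1 -> \bar R}) (m2 : {sigma_finite_measure set T2 -> \bar R}).
Implicit Types (f : T1 * T2 -> R).

Lemma integrable_fubini_G (g : T1 * T2 -> \bar R) : (m1 \x m2)%E.-integrable setT g ->
  m2.-integrable setT (fubini_G m1 g).
Proof.
move=> gi; have mg := measurable_int _ gi.
apply/integrableP; split; first exact: (measurable_fubini_G gi).
apply: le_lt_trans ((integrable21ltyP m1 m2 mg).1 gi); apply: ge0_le_integral => //.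
- by apply: measurableT_comp => //; exact: (measurable_fubini_G gi).
- apply: (measurable_fun_fubini_tonelli_G (abse \o g)) => //.
    exact: measurableT_comp.
  by move=> z; exact: abse_ge0.
- by move=> y _; apply: le_abse_integral => //; exact: measurableT_comp.
Qed.

Lemma integrable_Rfubini2 f : (m1 \x m2)%E.-integrable setT (EFin \o f) ->
  m2.-integrable setT (fun y => (\int[m1]_x f (x, y))%:E).
Proof. by move=> fi; apply: (integrable_fine (integrable_fubini_G fi)). Qed.

Lemma Rfubini f : (m1 \x m2)%E.-integrable setT (EFin \o f) ->
  \int[m1]_x \int[m2]_y f (x, y) = \int[m2]_y \int[m1]_x f (x, y).
Proof.
move=> fi; congr fine.
rewrite (integral_fine (integrable_fubini_F fi)) (integral_fine (integrable_fubini_G fi)).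
exact: Fubini.
Qed.

Lemma integrable_prod_bounded (g : T1 -> R) (h : T1 * T2 -> R) (C : R) :
  m1.-integrable setT (EFin \o g) -> measurable_fun setT h ->
  (forall z, `|h z| <= C) -> (m2 setT < +oo)%E ->
  (m1 \x m2)%E.-integrable setT (EFin \o (fun z => g z.1 * h z)).
Proof.
move=> gi mh hC m2oo.
have mg : measurable_fun setT g by apply/measurable_EFinP; exact: measurable_int gi.
have mg1 : measurable_fun setT (fun z : T1 * T2 => g z.1) by exact: measurableT_comp.
have gi1 : (m1 \x m2)%E.-integrable setT (EFin \o (fun z => g z.1)).
  apply/integrable12ltyP; first exact/measurable_EFinP.
  rewrite /=; under eq_integral do rewrite integral_cst//.
  rewrite ge0_integralZr//; last first.
    by apply/measurable_EFinP; exact: measurableT_comp.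
  have /integrableP[_ ?] := gi; rewrite lte_mul_pinfty//.
    exact: integral_ge0.
  by rewrite ge0_fin_numE// integral_ge0.
apply: (le_integrable measurableT _ _ (integrableZl measurableT C gi1)).
  by apply/measurable_EFinP; exact: measurable_funM.
move=> z _ /=; rewrite lee_fin !normrM mulrC ler_wpM2r//.
exact: le_trans (hC z) (ler_norm _).
Qed.
End real_fubini2.

Section uniform01.
Context {R : realType}.
(** Averages over a segment are integrals for this probability measure in the
    parameter. *)
Definition unif := uniform_prob (@ltr01 R).

Lemma unifT : unif [set: measurableTypeR R] = 1%E.
Proof. exact: (@probability_setT _ _ _ (uniform_prob (@ltr01 R))). Qed.

Lemma integral_unif (f : measurableTypeR R -> \bar R) : measurable_fun setT f ->
  (\int[unif]_s f s = \int[@lebesgue_measure R]_(s in `[0%R, 1%R]) f s)%E.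
Proof.
have H (g : measurableTypeR R -> \bar R) : measurable_fun setT g -> (forall s, 0 <= g s)%E ->
    (\int[unif]_s g s = \int[@lebesgue_measure R]_(s in `[0%R, 1%R]) g s)%E.
  by move=> mg g0; rewrite integral_uniform// subr0 invr1 mul1e.
move=> mf; rewrite integralE [RHS]integralE !H//; [exact: measurable_funeneg|exact: measurable_funepos].
Qed.

Lemma ae_unif : {ae unif, forall s : measurableTypeR R, 0 <= s <= 1}.
Proof.
exists (~` `[0, 1]%classic); split.
- by apply: measurableC; exact: measurable_itv.
- rewrite /unif /uniform_prob/= integral_uniform_pdf.
  by rewrite setICl integral_set0.
- by move=> s /= H; rewrite in_itv/=.
Qed.
End uniform01.

Section translation.
Context {R : realType} {N : nat}.
Local Notation mu := (@lebesgue_rV R N).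

Lemma measurable_shift (b : 'rV[R]_N) : measurable_fun setT (fun x : 'rV[R]_N => x + b).
Proof.
have := @measurable_affine R N 1 b; rewrite (_ : (fun x => _) = (fun x => x + b))//.
by apply/funext => x; rewrite scale1r.
Qed.

Lemma integral_shift (b : 'rV[R]_N) (f : 'rV[R]_N -> \bar R) : measurable_fun setT f ->
  (\int[mu]_x f (x + b)%R = \int[mu]_x f x)%E.
Proof.
move=> mf; rewrite integralE [RHS]integralE.
have mp : measurable_fun setT f^\+%E by exact: measurable_funepos.
have mn : measurable_fun setT f^\-%E by exact: measurable_funeneg.
rewrite -(integral_translation b mp); last by move=> x; exact: funepos_ge0.
rewrite -(integral_translation b mn); last by move=> x; exact: funeneg_ge0.
by congr (_ - _)%E; apply: eq_integral => x _; rewrite ?funeposE ?funenegE.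
Qed.

Lemma integrable_shift (b : 'rV[R]_N) (f : 'rV[R]_N -> \bar R) :
  mu.-integrable setT f -> mu.-integrable setT (fun x => f (x + b)).
Proof.
move=> /integrableP[mf foo]; apply/integrableP; split.
  by apply: (measurableT_comp mf); exact: measurable_shift.
by rewrite (@integral_shift b (abse \o f))//; exact: measurableT_comp.
Qed.
End translation.

(** * Bumps along segments *)

Section bounded.
Context {R : realType}.

Lemma flat_bounded k (t : R) : flat k t <= (k.+2)`!%:R.
Proof.
have f1 : (1:R) <= (k.+2)`!%:R by rewrite ler1n fact_gt0.
have [t1|t1] := leP t 1; last first.
  apply: le_trans f1; rewrite /flat (lt_trans _ t1)//.
  have t0 : 0 < t by exact: lt_trans t1.
  rewrite mulr_ile1 ?expR_ge0 ?exprn_ge0 ?invr_ge0 ?(ltW t0)//.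
    by rewrite exprn_ile1 ?invr_ge0 ?(ltW t0)// invf_le1// ltW.
  by rewrite -expR0 ler_expR oppr_le0 invr_ge0 (ltW t0).
have [t0|t0] := ltP 0 t; last by rewrite /flat ltNge t0.
by apply: (le_trans (flat_le k t)); rewrite ler_piMr// exprn_ile1 ?(ltW t0).
Qed.

Lemma flat_alg_bounded (f : R -> R) : flat_alg f -> exists C, forall t, `|f t| <= C.
Proof.
elim=> [k a b|c|f1 f2 _ [C1 H1] _ [C2 H2]|f1 f2 _ [C1 H1] _ [C2 H2]].
- by exists (k.+2)`!%:R => t; rewrite ger0_norm ?flat_ge0// flat_bounded.
- by exists `|c|.
- by exists (C1 + C2) => t; rewrite (le_trans (ler_normD _ _))// lerD.
- by exists (C1 * C2) => t; rewrite /GRing.mul/= normrM ler_pM.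
Qed.

Lemma tensor_bounded N (B : 'I_N -> R -> R) : (forall i, flat_alg (B i)) ->
  exists C, forall x, `|tensor B x| <= C.
Proof.
move=> FB; pose C i := projT1 (cid (flat_alg_bounded (FB i))).
have CP i := projT2 (cid (flat_alg_bounded (FB i))).
exists (\prod_(i < N) C i) => x; rewrite /tensor normr_prod.
by apply: ler_prod => i _; rewrite normr_ge0 CP.
Qed.

Lemma measurable_tensor N (B : 'I_N -> R -> R) : (forall i, flat_alg (B i)) ->
  measurable_fun setT (tensor B).
Proof. by move=> FB; apply: continuous_measurable_rV; exact: tensor_continuous. Qed.

End bounded.

Section shift.
Context {R : realType} {N : nat}.
Implicit Types (a b c x d : 'rV[R]_N).

Lemma tbump_shift k a b c x : tbump k a b (x - c) = tbump k (a + c) (b + c) x.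
Proof.
by apply: eq_bigr => i _; rewrite !mxE /bump1; congr (flat 0 (_ * _) * flat 0 (_ * _)); ring.
Qed.

Lemma derive1_bump_shift k (a b c t : R) :
  derive1 (bump1 k a b) (t - c) = derive1 (bump1 k (a + c) (b + c)) t.
Proof.
have -> : bump1 k (a + c) (b + c) = bump1 k a b \o (fun t => t - c).
  by apply/funext => s; rewrite /bump1/=; congr (flat 0 (_ * _) * flat 0 (_ * _)); ring.
have H1 := flat_alg_is_derive1 ((fun t => t - c) t) (flat_alg_bump k a b).
have H2 : is_derive t 1 (fun t : R => t - c) 1.
  apply: (is_derive_eq (is_deriveB (is_derive_id t 1) (is_derive_cst c t 1))).
  by rewrite subr0.
have [_ H] := @is_derive1_comp R (bump1 k a b) (fun t => t - c) t _ _ H1 H2.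
by rewrite [RHS]derive1E H mulr1.
Qed.

Definition dbump k a b i : 'rV[R]_N -> R := tensor_d i (fun j => bump1 k (a 0 j) (b 0 j)).

Lemma partial_tbump_shift k a b c i x :
  partial i (tbump k (a + c) (b + c)) x = dbump k a b i (x - c).
Proof.
rewrite /tbump partial_tensor; last by move=> j; exact: flat_alg_bump.
rewrite /dbump /tensor_d /tensor; apply: eq_bigr => j _; rewrite !mxE; case: eqP => _.
  by rewrite derive1_bump_shift.
by rewrite /bump1; congr (flat 0 (_ * _) * flat 0 (_ * _)); ring.
Qed.

Lemma dbump_bounded k a b i : exists C, forall x, `|dbump k a b i x| <= C.
Proof. by apply: tensor_bounded; apply: tensor_d_flat => j; exact: flat_alg_bump. Qed.

Lemma measurable_dbump k a b i : measurable_fun setT (dbump k a b i).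
Proof. by apply: measurable_tensor; apply: tensor_d_flat => j; exact: flat_alg_bump. Qed.

Lemma measurable_line d : measurable_fun setT
  (fun z : 'rV[R]_N * measurableTypeR R => z.1 + z.2 *: d).
Proof.
apply: measurable_fun_rV => i.
rewrite (_ : _ \o _ = (fun z : 'rV[R]_N * measurableTypeR R => Defs.coord i z.1 + z.2 * d 0 i)); last first.
  by apply/funext => x; rewrite /Defs.coord/= !mxE.
apply: measurable_funD.
  by apply: (measurableT_comp (measurable_coord i)); exact: measurable_fst.
by apply: measurable_funM => //; exact: measurable_snd.
Qed.

Local Notation mu := (@lebesgue_rV R N).

(** For each fixed parameter the line is a translation, which preserves the
    integral over the starting points. *)
Lemma integrable_line (w : 'rV[R]_N -> R) d : mu.-integrable setT (EFin \o w) ->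
  (mu \x unif)%E.-integrable setT (EFin \o (fun z => w (z.1 + z.2 *: d))).
Proof.
move=> wi; have mw : measurable_fun setT w by apply/measurable_EFinP; exact: measurable_int wi.
apply/integrable21ltyP => /=.
  by apply/measurable_EFinP; apply: measurableT_comp => //; exact: measurable_line.
rewrite (eq_integral (fun=> \int[mu]_x `|w x|%:E)%E); last first.
  move=> s _; rewrite -(@integral_shift _ _ (s *: d) (fun x => `|w x|%:E))//.
  by apply/measurable_EFinP; exact: measurableT_comp.
rewrite integral_cst// [X in (_ * X)%E]unifT mule1.
by have /integrableP[] := wi.
Qed.

(** The fundamental theorem of calculus along the segment from [y] to [y - d]. *)
Lemma tbump_line k a b d y :
  tbump k a b (y - d) - tbump k a b y =
  \int[unif]_s (\sum_(i < N) - d 0 i * dbump k a b i (y - s *: d)).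
Proof.
pose F (s : R) := tbump k a b (s *: (- d) + y).
pose f (s : R) := \sum_(i < N) - d 0 i * dbump k a b i (y - s *: d).
have FB i : flat_alg (bump1 k (a 0 i) (b 0 i)) by exact: flat_alg_bump.
have dF (s : R) : is_derive s 1 F (f s).
  apply: (is_derive_eq (tensor_line y (- d) s FB)).
  by apply: eq_bigr => i _; rewrite mxE scalerN addrC.
have cF : continuous F.
  move=> s; apply: differentiable_continuous; apply/derivable1_diffP.
  by have [] := dF s.
have cline : continuous (fun s : R => y - s *: d).
  move=> s; apply: cvgB; first exact: cvg_cst.
  by apply: cvgZr_tmp; exact: cvg_id.
have cf : continuous f.
  apply: (continuous_sum (F := fun i (s : R) => - d 0 i * dbump k a b i (y - s *: d))) => i s.
  apply: cvgM; first exact: cvg_cst.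
  apply: (@continuous_comp _ _ _ (fun s : R => y - s *: d) (dbump k a b i)); first exact: cline.
  by apply: tensor_continuous; exact: tensor_d_flat.
have mf : measurable_fun setT f by exact: continuous_measurable_fun.
rewrite /Rintegral integral_unif/=; last exact/measurable_EFinP.
rewrite (@continuous_FTC2 _ f F 0 1)//=.
- by rewrite /F scale1r scale0r add0r (addrC (- d)).
- by apply: continuous_subspaceT.
- split.
  + by move=> s _; have [] := dF s.
  + exact/cvg_at_right_filter/cF.
  + exact/cvg_at_left_filter/cF.
- by move=> s _; rewrite derive1E; have [_ ->] := dF s.
Qed.

End shift.

(** * Weak gradients along segments *)

Section weak_line.
Context {R : realType} {N : nat}.
Local Notation mu := (@lebesgue_rV R N).
Implicit Types (a b c x d : 'rV[R]_N).

Lemma measurable_integrable (w : 'rV[R]_N -> R) : mu.-integrable setT (EFin \o w) -> measurable_fun setT w.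
Proof. by move=> wi; apply/measurable_EFinP; exact: measurable_int wi. Qed.

Lemma integrable_mul_bounded (w h : 'rV[R]_N -> R) (C : R) : mu.-integrable setT (EFin \o w) ->
  measurable_fun setT h -> (forall x, `|h x| <= C) ->
  mu.-integrable setT (EFin \o (fun x => w x * h x)).
Proof.
move=> wi mh hC; apply: (le_integrable measurableT _ _ (integrableZl measurableT C wi)).
  by apply/measurable_EFinP; apply: measurable_funM => //; exact: measurable_integrable.
move=> x _ /=; rewrite lee_fin !normrM mulrC ler_wpM2r//.
exact: le_trans (hC x) (ler_norm _).
Qed.

Lemma Rintegral_shift c (f : 'rV[R]_N -> R) : measurable_fun setT f ->
  \int[mu]_x f (x + c) = \int[mu]_x f x.
Proof.
move=> mf; congr fine; apply: (@integral_shift _ _ c (EFin \o f)).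
exact/measurable_EFinP.
Qed.

Variables (Om : set 'rV[R]_N) (u : 'rV[R]_N -> R) (v : 'I_N -> 'rV[R]_N -> R).
Hypothesis ui : mu.-integrable setT (EFin \o u).
Hypothesis vi : forall i, mu.-integrable setT (EFin \o v i).
Hypothesis wD : forall k a b i, cbox a b `<=` Om ->
  \int[mu]_x (u x * partial i (tbump k a b) x) = - \int[mu]_x (v i x * tbump k a b x).

Variables (O : set 'rV[R]_N) (d : 'rV[R]_N).
Hypothesis oO : open O.
Hypothesis segO : forall x (s : R), O x -> 0 <= s <= 1 -> Om (x + s *: d).

(** The bump of a box in [O], moved along the segments that start in [O], remains
    a test function on [Om]. *)
Lemma weak_partial_tbump k a b i (s : R) : 0 <= s <= 1 -> cbox a b `<=` O ->
  \int[mu]_x (u x * dbump k a b i (x - s *: d)) = - \int[mu]_x (v i x * tbump k a b (x - s *: d)).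
Proof.
move=> s01 abO.
transitivity (\int[mu]_x (u x * partial i (tbump k (a + s *: d) (b + s *: d)) x)).
  by apply: eq_Rintegral => x _; rewrite partial_tbump_shift.
rewrite wD => [|y aby]; first by congr (- _); apply: eq_Rintegral => x _; rewrite tbump_shift.
rewrite -(subrK (s *: d) y); apply: segO => //; apply: abO => j.
by have := aby j; rewrite !mxE; lra.
Qed.

Lemma tbump_norm k a b x : `|tbump k a b x| <= 1.
Proof. by rewrite ger0_norm ?tbump_ge0// tbump_le1. Qed.

Let w x := \sum_(i < N) d 0 i * v i x.

Lemma integrable_sumZ (f : 'I_N -> 'rV[R]_N -> R) (c : 'I_N -> R) :
  (forall i, mu.-integrable setT (EFin \o f i)) ->
  mu.-integrable setT (EFin \o (fun x => \sum_(i < N) c i * f i x)).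
Proof.
move=> fi; rewrite (_ : _ \o _ = fun x => (\sum_(i <- index_enum 'I_N) (c i)%:E * (EFin \o f i) x)%E); last first.
  by apply/funext => x; rewrite /= -sumEFin.
by apply: integrable_sum => // i _; exact: integrableZl.
Qed.

Let wi : mu.-integrable setT (EFin \o w).
Proof. by apply: integrable_sumZ. Qed.

Lemma Rintegral_sumZ (f : 'I_N -> 'rV[R]_N -> R) (c : 'I_N -> R) :
  (forall i, mu.-integrable setT (EFin \o f i)) ->
  \int[mu]_x (\sum_(i < N) c i * f i x) = \sum_(i < N) c i * \int[mu]_x f i x.
Proof.
move=> fi; rewrite /Rintegral.
under eq_integral do rewrite -sumEFin.
rewrite (@integral_sum _ _ _ mu setT measurableT 'I_N (fun i x => (c i * f i x)%:E)); last first.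
  by move=> i; exact: (integrableZl measurableT (c i) (fi i)).
rewrite (eq_bigr (fun i => (c i * \int[mu]_x f i x)%:E)).
  by rewrite sumEFin.
move=> i _; rewrite EFinM fineK; last exact: (integrable_fin_num measurableT (fi i)).
exact: (integralZl measurableT (fi i)).
Qed.

Lemma integrable_line_tbump k a b :
  (mu \x unif)%E.-integrable setT (EFin \o (fun z => w (z.1 + z.2 *: d) * tbump k a b z.1)).
Proof.
apply: (le_integrable measurableT _ _ (integrable_line d wi)).
  apply/measurable_EFinP; apply: measurable_funM; last exact: (measurableT_comp (measurable_tbump k a b)).
  apply: (measurableT_comp (measurable_integrable wi)); exact: measurable_line.
by move=> z _ /=; rewrite lee_fin normrM ler_piMr// tbump_norm.
Qed.

(** The identity of [weak_line], tested against a bump.  A translation moves the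
    difference from [u] to the bump, where it is the integral of a derivative;
    the weak gradient then moves this derivative back to [u]. *)
Lemma weak_line_tbump k a b : cbox a b `<=` O ->
  \int[mu]_x ((u (x + d) - u x) * tbump k a b x) =
  \int[mu]_x \int[unif]_s (w (x + s *: d) * tbump k a b x).
Proof.
move=> abO; pose T := tbump k a b.
have mT : measurable_fun setT T by exact: measurable_tbump.
have mmu := measurable_integrable ui.
have mw := measurable_integrable wi.
have mTd c : measurable_fun setT (fun x => T (x - c)).
  by apply: (measurableT_comp mT); exact: measurable_shift.
have udi : mu.-integrable setT (EFin \o (fun x => u (x + d))).
  exact: (integrable_shift d ui).
pose g (y : 'rV[R]_N) (s : measurableTypeR R) : R := \sum_(i < N) - d 0 i * dbump k a b i (y - s *: d).
have [C gC] : exists C : R, forall y s, `|g y s| <= C.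
  pose C i := projT1 (cid (dbump_bounded k a b i)).
  have CP i := projT2 (cid (dbump_bounded k a b i)).
  exists (\sum_(i < N) `|d 0 i| * C i) => y s; apply: le_trans (ler_norm_sum _ _ _) _.
  by apply: ler_sum => i _; rewrite normrM normrN ler_wpM2l.
have mg : measurable_fun setT (fun z : 'rV[R]_N * measurableTypeR R => g z.1 z.2).
  apply: measurable_sum => i; apply: measurable_funM => //.
  apply: (measurableT_comp (measurable_dbump k a b i)).
  rewrite (_ : (fun z => _) = (fun z : 'rV[R]_N * measurableTypeR R => z.1 + z.2 *: (- d))).
    exact: measurable_line.
  by apply/funext => z; rewrite scalerN.
have Phi : (mu \x unif)%E.-integrable setT (EFin \o (fun z => u z.1 * g z.1 z.2)).
  apply: (integrable_prod_bounded ui mg (fun z => gC z.1 z.2)).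
  by rewrite [X in (X < _)%E]unifT ltry.
have Psi := integrable_line_tbump k a b.
transitivity (\int[mu]_y (u y * (T (y - d) - T y))).
  have i1 : mu.-integrable setT (EFin \o (fun x => u (x + d) * T x)).
    exact: (integrable_mul_bounded udi mT (tbump_norm k a b)).
  have i2 : mu.-integrable setT (EFin \o (fun x => u x * T x)).
    exact: (integrable_mul_bounded ui mT (tbump_norm k a b)).
  have i3 : mu.-integrable setT (EFin \o (fun x => u x * T (x - d))).
    by apply: (integrable_mul_bounded ui (mTd d) (C := 1)) => x; exact: tbump_norm.
  under eq_Rintegral do rewrite mulrBl.
  under [RHS]eq_Rintegral do rewrite mulrBr.
  transitivity (\int[mu]_x (u (x + d) * T x) - \int[mu]_x (u x * T x)).
    exact: (RintegralB measurableT i1 i2).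
  transitivity (\int[mu]_x (u x * T (x - d)) - \int[mu]_x (u x * T x)); last first.
    exact/esym/(RintegralB measurableT i3 i2).
  have -> : \int[mu]_x (u (x + d) * T x) = \int[mu]_x (u x * T (x - d)); last by [].
  rewrite -(@Rintegral_shift d (fun x => u x * T (x - d))); last exact: measurable_funM.
  by apply: eq_Rintegral => x _; rewrite addrK.
transitivity (\int[mu]_y \int[unif]_s (u y * g y s)).
  apply: eq_Rintegral => y _; rewrite tbump_line RintegralZl//.
  have mgy : measurable_fun setT (g y) by exact: (measurableT_comp mg (pair1_measurable y)).
  apply: (@measurable_bounded_integrable _ _ _ unif (g y) setT measurableT) => //.
    by rewrite [X in (X < _)%E]unifT ltry.
  exists C; split; first exact: num_real.
  by move=> M CM s _; apply: le_trans (gC y s) (ltW CM).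
rewrite (Rfubini Phi) (Rfubini Psi).
congr fine; apply: ae_eq_integral => //.
- exact: measurable_int (integrable_Rfubini2 Phi).
- exact: measurable_int (integrable_Rfubini2 Psi).
apply: filterS (@ae_unif R) => s s01 _ /=; congr EFin.
transitivity (\sum_(i < N) - d 0 i * \int[mu]_y (u y * dbump k a b i (y - s *: d))).
  rewrite -Rintegral_sumZ.
    apply: eq_Rintegral => y _; rewrite /g mulr_sumr; apply: eq_bigr => i _; ring.
  move=> i; have [Ci CiP] := dbump_bounded k a b i.
  apply: (integrable_mul_bounded ui (C := Ci)) => //.
  by apply: (measurableT_comp (measurable_dbump k a b i)); exact: measurable_shift.
under eq_bigr do rewrite weak_partial_tbump// mulrNN.
rewrite -(@Rintegral_sumZ (fun i x => v i x * T (x - s *: d))); last first.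
  by move=> i; apply: (integrable_mul_bounded (vi i) (mTd _) (C := 1)) => x; exact: tbump_norm.
rewrite -(@Rintegral_shift (s *: d)); last first.
  apply: measurable_sum => i; apply: measurable_funM => //; apply: measurable_funM => //.
  exact: measurable_integrable.
apply: eq_Rintegral => x _; rewrite /w mulr_suml; apply: eq_bigr => i _.
by rewrite addrK mulrA.
Qed.

(** A Sobolev function satisfies the fundamental theorem of calculus along almost
    every segment of a given direction: the tested identity holds for all bumps
    in [O], and the fundamental lemma removes them. *)
Lemma weak_line : {ae mu, forall x, O x ->
  u (x + d) - u x = \int[unif]_s w (x + s *: d)}.
Proof.
pose G x := \int[unif]_s w (x + s *: d).
have wl := integrable_line d wi.
have Gi : mu.-integrable setT (EFin \o G) by exact: (integrable_Rfubini1 wl).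
have udi : mu.-integrable setT (EFin \o (fun x => u (x + d))) by exact: (integrable_shift d ui).
have i1 : mu.-integrable setT (EFin \o (fun x => u (x + d) - u x)).
  exact: (integrableB measurableT udi ui).
have Fi : mu.-integrable setT (EFin \o (fun x => u (x + d) - u x - G x)).
  exact: (integrableB measurableT i1 Gi).
have := fundamental_lemma oO Fi; move=> /(_ _)H.
apply: filterS (H _) => [x /[apply] /eqP|k a b abO].
  by rewrite subr_eq0 => /eqP.
have mT : measurable_fun setT (tbump k a b) by exact: measurable_tbump.
have FTi := integrable_mul_bounded Fi mT (tbump_norm k a b).
rewrite -[LHS]fineK; last exact: (integrable_fin_num measurableT FTi).
congr EFin; change (\int[mu]_x ((u (x + d) - u x - G x) * tbump k a b x) = 0).
under eq_Rintegral do rewrite mulrBl.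
have iT1 := integrable_mul_bounded i1 mT (tbump_norm k a b).
have iT2 := integrable_mul_bounded Gi mT (tbump_norm k a b).
rewrite RintegralB// weak_line_tbump//; apply/eqP; rewrite subr_eq0; apply/eqP.
congr fine; apply: ae_eq_integral => //.
- exact: measurable_int (integrable_Rfubini1 (integrable_line_tbump k a b)).
- exact: measurable_int iT2.
apply: filterS (ae_integrable1 wl) => x xi _ /=; congr EFin.
by rewrite RintegralZr.
Qed.

End weak_line.

(** * Averages over the segments between two sets *)

Section jensen.
Context d (T : measurableType d) (R : realType) (m : {measure set T -> \bar R}).

(** The power lies above its tangent at 1.  This is Young's inequality with one
    factor equal to 1. *)
Lemma bernoulli_powR (p x : R) : 1 < p -> 0 <= x -> p * x <= x `^ p + (p - 1).
Proof.
move=> p1 x0; have p0 : 0 < p by lra.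
pose q := p / (p - 1).
have q0 : 0 < q by rewrite divr_gt0// subr_gt0.
have pq : p^-1 + q^-1 = 1 by rewrite /q invf_div -{1}(div1r p) -mulrDl subrKC divff// gt_eqF.
have := conjugate_powR x0 ler01 p0 q0 pq; rewrite mulr1 powR1 mul1r.
move=> /(ler_wpM2l (ltW p0)) /le_trans; apply.
rewrite le_eqVlt; apply/orP; left; apply/eqP.
by rewrite mulrDr /q; field; rewrite !gt_eqF// subr_gt0.
Qed.

(** Jensen's inequality, from the tangent to the power at the absolute value
    of the mean of [h]. *)
Lemma jensen_powR (D : set T) (h : T -> R) (p V : R) : 1 < p -> measurable D ->
  m D = V%:E -> 0 < V -> m.-integrable D (EFin \o h) ->
  ((V * (`|\int[m]_(x in D) h x| / V) `^ p)%:E <= \int[m]_(x in D) (`|h x| `^ p)%:E)%E.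
Proof.
move=> p1 mD mV V0 hi.
have p0 : 0 < p by lra.
have mh : measurable_fun D h by apply/measurable_EFinP; exact: measurable_int hi.
have mhn : measurable_fun D (fun x => `|h x|) by exact: measurableT_comp.
have mhp : measurable_fun D (fun x => `|h x| `^ p).
  by apply: (@measurableT_comp _ _ _ _ _ _ (@powR R ^~ p)) => //; exact: measurable_powR.
set I := \int[m]_(x in D) h x.
have [I0|I0] := eqVneq `|I| 0.
  rewrite I0 mul0r powR0 ?gt_eqF// mulr0; apply: integral_ge0 => x _.
  by rewrite lee_fin powR_ge0.
have In0 : 0 < `|I| by rewrite lt_neqAle eq_sym I0 normr_ge0.
set t := `|I| / V; have t0 : 0 < t by rewrite divr_gt0.
have J : (`|I|%:E <= \int[m]_(x in D) `|h x|%:E)%E.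
  rewrite /I EFin_normr_Rintegral//; apply: le_abse_integral => //.
  exact/measurable_EFinP.
have H : ((p * V)%:E <= (t^-1 `^ p)%:E * \int[m]_(x in D) (`|h x| `^ p)%:E + ((p - 1) * V)%:E)%E.
  apply: (@le_trans _ _ (\int[m]_(x in D) ((p * t^-1)%:E * `|h x|%:E))%E).
    rewrite ge0_integralZl//; last 2 first.
    - exact/measurable_EFinP.
    - by rewrite lee_fin mulr_ge0 ?invr_ge0 ?ltW.
    apply: (@le_trans _ _ ((p * t^-1)%:E * `|I|%:E)%E); last first.
      by apply: lee_wpmul2l => //; rewrite lee_fin mulr_ge0 ?invr_ge0 ?ltW.
    rewrite -EFinM lee_fin le_eqVlt; apply/orP; left; apply/eqP.
    by rewrite /t; field; rewrite I0 gt_eqF.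
  apply: (@le_trans _ _ (\int[m]_(x in D) ((t^-1 `^ p * `|h x| `^ p)%:E + (p - 1)%:E))%E).
    apply: ge0_le_integral => //.
    - by move=> x _; rewrite -EFinM lee_fin mulr_ge0// mulr_ge0 ?invr_ge0 ?ltW.
    - by apply: measurable_funeM; exact/measurable_EFinP.
    - apply/measurable_EFinP; apply: measurable_funD => //; exact: measurable_funM.
    - move=> x _; rewrite -EFinM -EFinD lee_fin -powRM ?invr_ge0 ?(ltW t0)//.
      by rewrite -mulrA; apply: bernoulli_powR => //; rewrite mulr_ge0 ?invr_ge0 ?(ltW t0).
  rewrite ge0_integralD//; last 3 first.
  - by move=> x _; rewrite lee_fin mulr_ge0 ?powR_ge0.
  - by apply/measurable_EFinP; exact: measurable_funM.
  - by move=> x _; rewrite lee_fin subr_ge0 ltW.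
  rewrite integral_cst// mV -EFinM leeD2r//.
  under eq_integral do rewrite EFinM.
  rewrite ge0_integralZl ?lee_fin ?powR_ge0//; exact/measurable_EFinP.
move: H; case: (\int[m]_(x in D) _)%E (@integral_ge0 _ _ _ m D (fun x => (`|h x| `^ p)%:E)) => [r|_ _|].
- move=> _; rewrite -EFinM -EFinD !lee_fin => H.
  have tp : 0 < t `^ p by rewrite powR_gt0.
  have H1 : V <= t^-1 `^ p * r by move: H; lra.
  have -> : r = t `^ p * (t^-1 `^ p * r).
    by rewrite mulrA -powRM ?invr_ge0 ?(ltW t0)// divff ?gt_eqF// powR1 mul1r.
  by rewrite mulrC ler_pM2l.
- by rewrite leey.
- by move=> + _; rewrite leeNy_eq => /(_ _)h0; have := h0 (fun x _ => powR_ge0 _ _).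
Qed.

End jensen.

Section segments.
Context {R : realType} {N : nat}.
Local Notation mu := (@lebesgue_rV R N).

Lemma measurable_rVDZ d (T : measurableType d) (f g : T -> 'rV[R]_N) (a : T -> R) :
  measurable_fun setT f -> measurable_fun setT g -> measurable_fun setT a ->
  measurable_fun setT (fun t => f t + a t *: g t).
Proof.
move=> mf mg ma; apply: measurable_fun_rV => i.
rewrite (_ : _ \o _ = (fun t => (Defs.coord i \o f) t + a t * (Defs.coord i \o g) t)); last first.
  by apply/funext => t; rewrite /Defs.coord/= !mxE.
apply: measurable_funD; first by apply: measurableT_comp => //; exact: measurable_coord.
by apply: measurable_funM => //; apply: measurableT_comp => //; exact: measurable_coord.
Qed.

Lemma measurable_rVB d (T : measurableType d) (f g : T -> 'rV[R]_N) :
  measurable_fun setT f -> measurable_fun setT g -> measurable_fun setT (fun t => f t - g t).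
Proof.
move=> mf mg; rewrite (_ : (fun t => _) = (fun t => f t + (-1) *: g t)).
  by apply: measurable_rVDZ.
by apply/funext => t; rewrite scaleN1r.
Qed.

Variables (e : 'rV[R]_N -> \bar R).
Hypothesis me : measurable_fun setT e.
Hypothesis e0 : forall x, (0 <= e x)%E.

Lemma integral_dilation_le (a : R) (b : 'rV[R]_N) : 2^-1 <= a ->
  (\int[mu]_x e (a *: x + b)%R <= (2 ^+ N)%:E * \int[mu]_x e x)%E.
Proof.
move=> a2; have a0 : 0 < a by apply: lt_le_trans a2; rewrite invr_gt0.
rewrite [X in (_ <= _ * X)%E](integral_dilation b a0 me e0) muleA -EFinM -exprMn.
apply: lee_pemull; first exact: integral_ge0.
by rewrite lee_fin exprn_ege1// mulrC -ler_pdivrMr// div1r.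
Qed.

Variables (A B : set 'rV[R]_N).
Hypothesis (mA : measurable A) (mB : measurable B).

Let chi (x z : 'rV[R]_N) : \bar R := (\1_A x * \1_B z)%:E.

Let chi_ge0 x z : (0 <= chi x z)%E.
Proof. by rewrite lee_fin mulr_ge0. Qed.

Let chi_leA x z : (chi x z <= (\1_A x)%:E)%E.
Proof. by rewrite lee_fin !indicE; do 2!case: (_ \in _); rewrite ?(mulr0, mulr1). Qed.

Let chi_leB x z : (chi x z <= (\1_B z)%:E)%E.
Proof. by rewrite lee_fin !indicE; do 2!case: (_ \in _); rewrite ?(mul0r, mul1r). Qed.

Let mchi d (T : measurableType d) (f g : T -> 'rV[R]_N) :
  measurable_fun setT f -> measurable_fun setT g ->
  measurable_fun setT (fun t => chi (f t) (g t)).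
Proof.
move=> mf mg; apply/measurable_EFinP; apply: measurable_funM.
  have mI : measurable_fun setT (\1_A : 'rV[R]_N -> R) by exact: measurable_indic.
  exact: (measurableT_comp mI mf).
have mI : measurable_fun setT (\1_B : 'rV[R]_N -> R) by exact: measurable_indic.
exact: (measurableT_comp mI mg).
Qed.

Lemma measurable_segment d (T : measurableType d) (f g : T -> 'rV[R]_N) (a : T -> R) :
  measurable_fun setT f -> measurable_fun setT g -> measurable_fun setT a ->
  measurable_fun setT (fun t => (chi (f t) (g t) * e (f t + a t *: (g t - f t))%R)%E).
Proof.
move=> mf mg ma; apply: emeasurable_funM; first exact: mchi.
by apply: (measurableT_comp me); apply: measurable_rVDZ => //; exact: measurable_rVB.
Qed.

(** The point [x + s *: (z - x)] is a dilation of [x] of ratio [1 - s] when [z] is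
    fixed, and of [z] of ratio [s] when [x] is fixed.  One of the two ratios is at
    least one half, so that one of the two changes of variables costs at most a
    factor [2 ^+ N]. *)
Lemma integral_segment_le (s : R) : 0 <= s <= 1 ->
  (\int[mu]_x \int[mu]_z (chi x z * e (x + s *: (z - x))%R) <=
   (2 ^+ N)%:E * (mu A + mu B) * \int[mu]_x e x)%E.
Proof.
move=> /andP[s0 s1].
set c := ((2 ^+ N)%:E * \int[mu]_x e x)%E.
have c0 : (0 <= c)%E by rewrite mule_ge0 ?lee_fin ?exprn_ge0// integral_ge0.
have half (C D : set 'rV[R]_N) : measurable C -> measurable D ->
    (\int[mu]_x ((\1_C x)%:E * c) <= (2 ^+ N)%:E * (mu C + mu D) * \int[mu]_x e x)%E.
  move=> mC mD; rewrite ge0_integralZr//; last first.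
    by apply/measurable_EFinP; exact: measurable_indic.
  rewrite integral_indic// setIT /c muleCA muleA; apply: lee_wpmul2r; first exact: integral_ge0.
  by apply: lee_wpmul2l; rewrite ?lee_fin ?exprn_ge0// leeDl.
have mF : measurable_fun setT (fun t : 'rV[R]_N * 'rV[R]_N => (chi t.1 t.2 * e (t.1 + s *: (t.2 - t.1))%R)%E).
  by apply: (@measurable_segment _ _ fst snd (cst s)).
have F0 t : (0 <= chi t.1 t.2 * e (t.1 + s *: (t.2 - t.1))%R)%E by rewrite mule_ge0.
have [s2|s2] := leP s 2^-1.
- have := @fubini_tonelli _ _ _ _ R mu mu _ mF F0; rewrite /fubini_F /fubini_G/= => ->.
  rewrite addeC; apply: le_trans (half B A mB mA).
  apply: ge0_le_integral => //.
  + by move=> z _; apply: integral_ge0 => x _; exact: (F0 (x, z)).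
  + exact: (measurable_fun_fubini_tonelli_G _ mF F0).
  + apply: emeasurable_funM; last exact: measurable_cst.
    by apply/measurable_EFinP; exact: measurable_indic.
  move=> z _; apply: (@le_trans _ _ (\int[mu]_x ((\1_B z)%:E * e ((1 - s) *: x + s *: z)%R))%E).
    apply: ge0_le_integral => //.
    + by move=> x _; exact: (F0 (x, z)).
    + exact: (measurableT_comp mF (pair2_measurable z)).
    + by apply: measurable_funeM; apply: (measurableT_comp me); exact: measurable_affine.
    move=> x _; rewrite (_ : (1 - s) *: x + s *: z = x + s *: (z - x))%R; last first.
      by rewrite scalerBl scalerBr scale1r -addrA; congr (_ + _); rewrite addrC.
    by apply: lee_wpmul2r => //; exact: chi_leB.
  rewrite ge0_integralZl//; [|by apply: (measurableT_comp me); exact: measurable_affine].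
  apply: lee_wpmul2l => //; apply: integral_dilation_le; lra.
- apply: le_trans (half A B mA mB).
  apply: ge0_le_integral => //.
  + by move=> x _; apply: integral_ge0 => z _; exact: (F0 (x, z)).
  + exact: (measurable_fun_fubini_tonelli_F _ mF F0).
  + apply: emeasurable_funM; last exact: measurable_cst.
    by apply/measurable_EFinP; exact: measurable_indic.
  move=> x _; apply: (@le_trans _ _ (\int[mu]_z ((\1_A x)%:E * e (s *: z + (1 - s) *: x)%R))%E).
    apply: ge0_le_integral => //.
    + by move=> z _; exact: (F0 (x, z)).
    + exact: (measurableT_comp mF (pair1_measurable x)).
    + by apply: measurable_funeM; apply: (measurableT_comp me); exact: measurable_affine.
    move=> z _; rewrite (_ : s *: z + (1 - s) *: x = x + s *: (z - x))%R; last first.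
      by rewrite scalerBl scalerBr scale1r addrC -addrA; congr (_ + _); rewrite addrC.
    by apply: lee_wpmul2r => //; exact: chi_leA.
  rewrite ge0_integralZl//; [|by apply: (measurableT_comp me); exact: measurable_affine].
  apply: lee_wpmul2l => //; apply: integral_dilation_le; lra.
Qed.

Lemma integral_segments_le :
  (\int[mu]_x \int[mu]_z (chi x z * \int[unif]_s e (x + s *: (z - x))%R) <=
   (2 ^+ N)%:E * (mu A + mu B) * \int[mu]_x e x)%E.
Proof.
have mF : measurable_fun setT (fun t : ('rV[R]_N * 'rV[R]_N) * measurableTypeR R =>
    (chi t.1.1 t.1.2 * e (t.1.1 + t.2 *: (t.1.2 - t.1.1))%R)%E).
  apply: (@measurable_segment _ _ (fst \o fst) (snd \o fst) snd) => //;
    exact: measurableT_comp.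
have F0 x z (s : R) : (0 <= chi x z * e (x + s *: (z - x))%R)%E by rewrite mule_ge0.
have c0 : (0 <= (2 ^+ N)%:E * (mu A + mu B) * \int[mu]_x e x)%E.
  by rewrite mule_ge0 ?integral_ge0// mule_ge0 ?lee_fin ?exprn_ge0// adde_ge0.
(* The parameter is moved to the outside, past one endpoint at a time. *)
have swap1 x : (\int[mu]_z (chi x z * \int[unif]_s e (x + s *: (z - x))%R) =
    \int[unif]_s \int[mu]_z (chi x z * e (x + s *: (z - x))%R))%E.
  have mF1 : measurable_fun setT (fun t : 'rV[R]_N * measurableTypeR R =>
      (chi x t.1 * e (x + t.2 *: (t.1 - x))%R)%E).
    by apply: (@measurable_segment _ _ (cst x) fst snd).
  have := @fubini_tonelli _ _ _ _ R mu unif _ mF1 (fun t => F0 x t.1 t.2).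
  rewrite /fubini_F /fubini_G/= => <-; apply: eq_integral => z _.
  rewrite ge0_integralZl//.
  apply: (measurableT_comp me).
  by apply: (@measurable_rVDZ _ _ (cst x) (cst (z - x)) id).
under eq_integral do rewrite swap1.
have mF2 : measurable_fun setT (fun t : 'rV[R]_N * measurableTypeR R =>
    (\int[mu]_z (chi t.1 z * e (t.1 + t.2 *: (z - t.1))%R))%E).
  have mF3 : measurable_fun setT (fun t : ('rV[R]_N * measurableTypeR R) * 'rV[R]_N =>
      (chi t.1.1 t.2 * e (t.1.1 + t.1.2 *: (t.2 - t.1.1))%R)%E).
    by apply: (@measurable_segment _ _ (fst \o fst) snd (snd \o fst)) => //;
      exact: measurableT_comp.
  exact: (@measurable_fun_fubini_tonelli_F _ _ _ _ _ mu _ mF3 (fun t => F0 _ _ _)).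
have F20 (t : 'rV[R]_N * measurableTypeR R) : (0 <= \int[mu]_z (chi t.1 z * e (t.1 + t.2 *: (z - t.1))%R))%E.
  by apply: integral_ge0 => z _; exact: F0.
have := @fubini_tonelli _ _ _ _ R mu unif _ mF2 F20.
rewrite /fubini_F /fubini_G/= => ->.
apply: (@le_trans _ _ (\int[unif]_s ((2 ^+ N)%:E * (mu A + mu B) * \int[mu]_x e x))%E).
  apply: ae_ge0_le_integral => //.
  - by move=> s _; apply: integral_ge0 => x _; exact: (F20 (x, s)).
  - exact: (measurable_fun_fubini_tonelli_G _ mF2 F20).
  - by apply: filterS (@ae_unif R) => s s01 _; exact: integral_segment_le.
by rewrite integral_cst// [X in (_ * X)%E]unifT mule1.
Qed.

(** Integrating an estimate that holds for almost every start point, separately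
    for each displacement, over all pairs of points of two sets. *)
Lemma integral_pairs_le (g : 'rV[R]_N -> 'rV[R]_N -> \bar R) (M : R) : 0 <= M ->
  measurable_fun setT (fun t => g t.1 t.2) -> (forall x z, 0 <= g x z)%E ->
  (forall d, {ae mu, forall x, A x -> B (x + d) ->
     (g x (x + d)%R <= M%:E * \int[unif]_s e (x + s *: d)%R)%E}) ->
  (\int[mu]_(x in A) \int[mu]_(z in B) g x z <=
   M%:E * ((2 ^+ N)%:E * (mu A + mu B) * \int[mu]_x e x))%E.
Proof.
move=> M0 mg g0 H.
pose k x z := (chi x z * g x z)%E.
pose l x z := (chi x z * (M%:E * \int[unif]_s e (x + s *: (z - x))%R))%E.
have k0 x z : (0 <= k x z)%E by rewrite mule_ge0.
have I0 x z : (0 <= \int[unif]_s e (x + s *: (z - x))%R)%E by exact: integral_ge0.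
have l0 x z : (0 <= l x z)%E by rewrite mule_ge0// mule_ge0// lee_fin.
have mk : measurable_fun setT (fun t : 'rV[R]_N * 'rV[R]_N => k t.1 t.2).
  by apply: emeasurable_funM => //; exact: mchi.
have mI : measurable_fun setT (fun t : 'rV[R]_N * 'rV[R]_N => \int[unif]_s e (t.1 + s *: (t.2 - t.1))%R)%E.
  have mJ : measurable_fun setT (fun t : ('rV[R]_N * 'rV[R]_N) * measurableTypeR R => e (t.1.1 + t.2 *: (t.1.2 - t.1.1))%R).
    apply: (measurableT_comp me); apply: (@measurable_rVDZ _ _ (fst \o fst) (fun t : ('rV[R]_N * 'rV[R]_N) * measurableTypeR R => t.1.2 - t.1.1) snd) => //.
      exact: measurableT_comp.
    by apply: (@measurable_rVB _ _ (snd \o fst) (fst \o fst)); exact: measurableT_comp.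
  exact: (@measurable_fun_fubini_tonelli_F _ _ _ _ _ unif _ mJ (fun t => e0 _)).
have ml : measurable_fun setT (fun t : 'rV[R]_N * 'rV[R]_N => l t.1 t.2).
  apply: emeasurable_funM; first exact: mchi.
  exact: measurable_funeM.
(* Both double integrals are written in the variables start point and displacement. *)
have mhd h : measurable_fun setT (fun t : 'rV[R]_N * 'rV[R]_N => h t.1 t.2) ->
    measurable_fun setT (fun t : 'rV[R]_N * 'rV[R]_N => h t.1 (t.1 + t.2)%R : \bar R).
  move=> mh; rewrite (_ : (fun t => _) = (fun t => h t.1 t.2) \o (fun t => (t.1, (t.1 + (1:R) *: t.2)%R))).
    apply: measurableT_comp => //; apply/measurable_fun_pairP; split => /=; first exact: measurable_fst.
    exact: (@measurable_rVDZ _ _ fst snd (cst 1)).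
  by apply/funext => t; rewrite /= scale1r.
have shift h : measurable_fun setT (fun t : 'rV[R]_N * 'rV[R]_N => h t.1 t.2) -> (forall x z, 0 <= h x z)%E ->
    (\int[mu]_x \int[mu]_z h x z = \int[mu]_d \int[mu]_x h x (x + d)%R)%E.
  move=> mh h0.
  have := @fubini_tonelli _ _ _ _ R mu mu _ (mhd _ mh) (fun t => h0 _ _).
  rewrite /fubini_F /fubini_G/= => <-; apply: eq_integral => x _.
  rewrite -(integral_translation x (f := h x))//; last exact: (measurableT_comp mh (pair1_measurable x)).
  by apply: eq_integral => d _; rewrite addrC.
apply: (@le_trans _ _ (\int[mu]_x \int[mu]_z k x z)%E).
  rewrite integral_mkcond le_eqVlt; apply/orP; left; apply/eqP; apply: eq_integral => x _.
  rewrite patchE integral_mkcond; case: ifPn => xA.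
    by apply: eq_integral => z _; rewrite patchE /k /chi !indicE xA mul1r; case: (z \in B); rewrite ?mul1e ?mul0e.
  rewrite integral0_eq// => z _.
  by rewrite /k /chi !indicE (negbTE xA) mul0r mul0e.
apply: (@le_trans _ _ (\int[mu]_x \int[mu]_z l x z)%E).
  rewrite (shift k mk k0) (shift l ml l0); apply: ge0_le_integral => //.
  - by move=> d _; apply: integral_ge0.
  - exact: (measurable_fun_fubini_tonelli_G _ (mhd _ mk) (fun t => k0 _ _)).
  - exact: (measurable_fun_fubini_tonelli_G _ (mhd _ ml) (fun t => l0 _ _)).
  move=> d _; apply: ae_ge0_le_integral => //.
  - exact: (measurableT_comp (mhd _ mk) (pair2_measurable d)).
  - exact: (measurableT_comp (mhd _ ml) (pair2_measurable d)).
  apply: filterS (H d) => x Hx _; rewrite /k /l /chi !indicE.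
  have [xA|xA] := boolP (x \in A); last by rewrite mul0r !mul0e.
  have [zB|zB] := boolP ((x + d)%R \in B); last by rewrite mulr0 !mul0e.
  rewrite mul1r !mul1e (_ : x + d - x = d)%R; last by rewrite addrC addKr.
  apply: Hx; first by rewrite inE in xA.
  by rewrite inE in zB.
have mJ : measurable_fun setT (fun t : 'rV[R]_N * 'rV[R]_N =>
    (chi t.1 t.2 * \int[unif]_s e (t.1 + s *: (t.2 - t.1))%R)%E).
  by apply: emeasurable_funM => //; exact: mchi.
have J0 x z : (0 <= chi x z * \int[unif]_s e (x + s *: (z - x))%R)%E by rewrite mule_ge0.
rewrite /l; under eq_integral do under eq_integral do rewrite muleCA.
rewrite (eq_integral (fun x => M%:E * \int[mu]_z (chi x z * \int[unif]_s e (x + s *: (z - x))%R))%E); last first.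
  by move=> x _; rewrite ge0_integralZl//; exact: (measurableT_comp mJ (pair1_measurable x)).
rewrite ge0_integralZl//; last 2 first.
- exact: (measurable_fun_fubini_tonelli_F _ mJ (fun t => J0 _ _)).
- by move=> x _; exact: integral_ge0.
by apply: lee_wpmul2l; rewrite ?lee_fin//; exact: integral_segments_le.
Qed.

End segments.

(** * Oscillation over pairs of sets *)

Section pair_energy.
Context {R : realType} {N : nat}.
Local Notation mu := (@lebesgue_rV R N).
Variables (p : R) (u : 'rV[R]_N -> R).
Hypothesis (p0 : 0 < p) (mfu : measurable_fun setT u).
Implicit Types A B C : set 'rV[R]_N.
Local Open Scope ereal_scope.

Definition gap (x z : 'rV[R]_N) : \bar R := (`|u x - u z| `^ p)%:E.

(** This measure of oscillation refers to no mean value of [u], which lets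
    estimates for overlapping sets be combined. *)
Definition osc A B : \bar R := \int[mu]_(x in A) \int[mu]_(z in B) gap x z.

Lemma gap_ge0 x z : 0 <= gap x z.
Proof. by rewrite lee_fin powR_ge0. Qed.

Lemma gapC x z : gap x z = gap z x.
Proof. by rewrite /gap distrC. Qed.

Lemma measurable_gap : measurable_fun setT (fun t : 'rV[R]_N * 'rV[R]_N => gap t.1 t.2).
Proof.
apply/measurable_EFinP; apply: (@measurableT_comp _ _ _ _ _ _ (@powR R ^~ p)).
  exact: measurable_powR.
by apply: measurableT_comp => //; apply: measurable_funB; exact: measurableT_comp.
Qed.

Lemma measurable_gap1 x D : measurable_fun D (gap x).
Proof.
apply: measurable_funTS; exact: (measurableT_comp measurable_gap (pair1_measurable x)).
Qed.

Lemma measurable_int_gap1 B D : measurable B -> measurable_fun D (fun x => \int[mu]_(z in B) gap x z).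
Proof.
move=> mB; apply: measurable_funTS; under eq_fun do rewrite integral_mkcond.
pose f (t : 'rV[R]_N * 'rV[R]_N) := (\1_B t.2)%:E * gap t.1 t.2.
have mf : measurable_fun setT f.
  apply: emeasurable_funM; last exact: measurable_gap.
  have mI : measurable_fun setT (\1_B : 'rV[R]_N -> R) by exact: measurable_indic.
  by apply/measurable_EFinP; exact: (measurableT_comp mI measurable_snd).
have f0 t : 0 <= f t by rewrite mule_ge0 ?gap_ge0// lee_fin.
have := measurable_fun_fubini_tonelli_F (m2 := mu) f mf f0.
rewrite (_ : fubini_F _ _ = (fun x => \int[mu]_z (gap x \_ B) z))//.
apply/funext => x; apply: eq_integral => z _; rewrite patchE /f/= indicE.
by case: (z \in B); rewrite ?mul1e ?mul0e.
Qed.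

Lemma osc_ge0 A B : 0 <= osc A B.
Proof. by apply: integral_ge0 => x _; apply: integral_ge0 => z _; exact: gap_ge0. Qed.

Lemma oscC A B : measurable A -> measurable B -> osc A B = osc B A.
Proof.
move=> mA mB.
pose f (t : 'rV[R]_N * 'rV[R]_N) := (\1_A t.1 * \1_B t.2)%:E * gap t.1 t.2.
have mf : measurable_fun setT f.
  apply: emeasurable_funM; last exact: measurable_gap.
  have mI C : measurable C -> measurable_fun setT (\1_C : 'rV[R]_N -> R) by move=> ?; exact: measurable_indic.
  apply/measurable_EFinP; apply: measurable_funM.
    exact: (measurableT_comp (mI _ mA) measurable_fst).
  exact: (measurableT_comp (mI _ mB) measurable_snd).
have f0 t : 0 <= f t by rewrite mule_ge0 ?gap_ge0// lee_fin mulr_ge0.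
have H C D (h : 'rV[R]_N -> 'rV[R]_N -> \bar R) :
    \int[mu]_(x in C) \int[mu]_(z in D) h x z =
    \int[mu]_x \int[mu]_z ((\1_C x * \1_D z)%:E * h x z).
  rewrite integral_mkcond; apply: eq_integral => x _; rewrite patchE.
  case: ifPn => xC.
    rewrite integral_mkcond; apply: eq_integral => z _; rewrite patchE !indicE xC mul1r.
    by case: (z \in D); rewrite ?mul1e ?mul0e.
  by rewrite integral0_eq// => z _; rewrite !indicE (negbTE xC) mul0r mul0e.
rewrite /osc (H A B gap) (H B A gap); have := @fubini_tonelli _ _ _ _ R mu mu _ mf f0.
rewrite /fubini_F /fubini_G/f/= => ->.
by apply: eq_integral => x _; apply: eq_integral => z _; rewrite mulrC gapC.
Qed.

Lemma gap_triangle x y z : gap x z <= (2 `^ p)%:E * (gap x y + gap y z).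
Proof.
rewrite /gap -EFinD -EFinM lee_fin.
have [a0 b0] : (0 <= `|u x - u y| /\ 0 <= `|u y - u z|)%R by [].
have ab : (`|u x - u z| <= `|u x - u y| + `|u y - u z|)%R.
  by rewrite -(subrKA (u y) (u x)); exact: ler_normD.
move: a0 b0 ab; move: (`|u x - u y|)%R (`|u y - u z|)%R => a b a0 b0 ab.
have H (c : R) : (0 <= c)%R -> (`|u x - u z| <= 2 * c)%R -> (`|u x - u z| `^ p <= 2 `^ p * c `^ p)%R.
  by move=> c0 h; rewrite -powRM// ge0_ler_powR ?nnegrE ?mulr_ge0// ltW.
have [h|h] := leP a b.
  apply: (le_trans (H b b0 _)); first by lra.
  by rewrite ler_wpM2l ?powR_ge0// lerDr powR_ge0.
apply: (le_trans (H a a0 _)); first by lra.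
by rewrite ler_wpM2l ?powR_ge0// lerDl powR_ge0.
Qed.

(** A third point is inserted, and averaged over [B]. *)
Lemma osc_triangle A B C : measurable A -> measurable B -> measurable C ->
  osc A C * mu B <= (2 `^ p)%:E * (osc A B * mu C + osc B C * mu A).
Proof.
move=> mA mB mC.
pose a x := \int[mu]_(y in B) gap x y.
have a0 x : 0 <= a x by apply: integral_ge0 => y _; exact: gap_ge0.
have ma D : measurable_fun D a by exact: measurable_int_gap1.
have H x z : gap x z * mu B <= (2 `^ p)%:E * (a x + a z).
  rewrite -integral_cst//; apply: (@le_trans _ _ (\int[mu]_(y in B) ((2 `^ p)%:E * (gap x y + gap z y)))).
    apply: ge0_le_integral => //.
    - by move=> y _; exact: gap_ge0.
    - by apply: measurable_funeM; apply: emeasurable_funD; exact: measurable_gap1.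
    - by move=> y _; rewrite (gapC z); exact: gap_triangle.
  rewrite ge0_integralZl ?lee_fin ?powR_ge0//.
  - by rewrite ge0_integralD//; [move=> y _; exact: gap_ge0|exact: measurable_gap1|
      move=> y _; exact: gap_ge0|exact: measurable_gap1].
  - by apply: emeasurable_funD; exact: measurable_gap1.
  - by move=> y _; rewrite adde_ge0 ?gap_ge0.
rewrite -ge0_integralZr//; last 2 first.
- exact: measurable_int_gap1.
- by move=> x _; apply: integral_ge0 => z _; exact: gap_ge0.
apply: (@le_trans _ _ (\int[mu]_(x in A) ((2 `^ p)%:E * (a x * mu C + osc C B)))).
  apply: ge0_le_integral => //.
  - by move=> x _; rewrite mule_ge0//; apply: integral_ge0 => z _; exact: gap_ge0.
  - by apply: emeasurable_funM => //; exact: measurable_int_gap1.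
  - apply: measurable_funeM; apply: emeasurable_funD => //.
    exact: emeasurable_funM.
  move=> x _; rewrite -ge0_integralZr//; last 2 first.
  - exact: measurable_gap1.
  - by move=> z _; exact: gap_ge0.
  apply: (@le_trans _ _ (\int[mu]_(z in C) ((2 `^ p)%:E * (a x + a z)))).
    apply: ge0_le_integral => //.
    - by move=> z _; rewrite mule_ge0// gap_ge0.
    - by apply: emeasurable_funM => //; exact: measurable_gap1.
    - by apply: measurable_funeM; exact: emeasurable_funD.
  rewrite ge0_integralZl ?lee_fin ?powR_ge0//.
  - rewrite ge0_integralD//.
    by rewrite (@integral_cst _ _ _ mu C mC).
  - exact: emeasurable_funD.
  - by move=> z _; exact: adde_ge0.
rewrite ge0_integralZl ?lee_fin ?powR_ge0//.
- rewrite ge0_integralD//.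
  + rewrite (oscC mB mC) (@integral_cst _ _ _ mu A mA (osc C B)).
    by rewrite (@ge0_integralZr _ _ _ mu A mA a (ma A) (mu C) (fun x _ => a0 x) (measure_ge0 _ _)).
  + by move=> x _; exact: mule_ge0.
  + exact: emeasurable_funM.
  + by move=> x _; exact: osc_ge0.
- by apply: emeasurable_funD => //; exact: emeasurable_funM.
- by move=> x _; rewrite adde_ge0 ?osc_ge0// mule_ge0.
Qed.

Lemma osc_bigcup (I : finType) (A : I -> set 'rV[R]_N) B : (forall i, measurable (A i)) -> measurable B ->
  osc (\bigcup_i A i) B <= \sum_(i : I) osc (A i) B.
Proof.
move=> mA mB.
pose a x := \int[mu]_(z in B) gap x z.
have a0 x : 0 <= a x by apply: integral_ge0 => y _; exact: gap_ge0.
have ma D : measurable_fun D a by exact: measurable_int_gap1.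
change (\int[mu]_(x in \bigcup_i A i) a x <= \sum_(i : I) \int[mu]_(x in A i) a x).
rewrite integral_mkcond; under eq_bigr do rewrite integral_mkcond.
have mai i : measurable_fun setT (a \_ (A i)) by apply/(measurable_restrictT _ (mA i)).
have a0i i x : 0 <= (a \_ (A i)) x by rewrite patchE; case: ifP.
rewrite -ge0_integral_sum//; apply: ge0_le_integral => //.
- by move=> x _; rewrite patchE; case: ifP.
- have mU : measurable (\bigcup_i A i).
    by apply: countable_bigcupT_measurable => //; exact: countableP.
  by apply/(measurable_restrictT _ mU).
- exact: emeasurable_sum.
- move=> x _; rewrite patchE; case: ifPn => [|_]; last by apply: sume_ge0 => i _.
  rewrite inE => -[i _ Aix]; rewrite (bigD1 i)//= {1}patchE mem_set// leeDl//.
  by apply: sume_ge0 => j _.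
Qed.

End pair_energy.

(** * Chains of balls through a connected set *)

Section chains.
Context {R : realType} {N : nat}.
Implicit Types (x y z : 'rV[R]_N) (K : set 'rV[R]_N).

(** The cells of a cubic grid over the ball.  Their number depends on the ball and
    on the mesh only: this is what makes the final constant independent of the
    connected set. *)
Lemma grid_cells (rho delta : R) : 0 < rho -> 0 < delta ->
  exists (I : finType) (cell : 'rV[R]_N -> I), forall x y,
    eball 0 rho x -> eball 0 rho y -> cell x = cell y -> enorm (x - y) < delta.
Proof.
move=> rho0 d0; pose h := delta / N.+1%:R.
have h0 : 0 < h by rewrite divr_gt0.
pose m := Num.truncn (2 * rho / h).
pose t x i := Num.truncn ((x 0 i + rho) / h).
exists {ffun 'I_N -> 'I_m.+1}, (fun x => [ffun i => inord (t x i)]) => x y xb yb xy.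
have coordP z i : eball 0 rho z -> 0 <= (z 0 i + rho) / h /\ (t z i < m.+1)%N.
  rewrite /eball/= sub0r enormN => zb.
  have := le_lt_trans (coord_le_enorm z i) zb; rewrite ltr_norml => /andP[z1 z2].
  have z0 : 0 <= (z 0 i + rho) / h by rewrite divr_ge0 ?ltW//; lra.
  by split => //; rewrite ltnS le_truncn// ler_pM2r ?invr_gt0//; lra.
have xyi i : `|x 0 i - y 0 i| <= h.
  have [x0 xm] := coordP x i xb; have [y0 ym] := coordP y i yb.
  have txy : t x i = t y i.
    move/ffunP : xy => /(_ i); rewrite !ffunE => /(congr1 val).
    by rewrite /= !inordK.
  have /andP[x1 x2] := truncn_itv x0; have /andP[y1 y2] := truncn_itv y0.
  move: x1 x2; rewrite -/(t x i) txy => x1 x2.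
  have : `|(x 0 i + rho) / h - (y 0 i + rho) / h| <= 1.
    by move: y1 y2 x1 x2; rewrite -/(t y i) -natr1 ler_norml; lra.
  rewrite -mulrBl normrM (gtr0_norm (x := h^-1)) ?invr_gt0// ler_pdivrMr// mul1r.
  by rewrite (_ : x 0 i + rho - (y 0 i + rho) = x 0 i - y 0 i)//; ring.
apply: (@le_lt_trans _ _ (N%:R * h)); last first.
  by rewrite /h mulrA ltr_pdivrMr// mulrC ltr_pM2l// ltr_nat.
rewrite enorm_le; last by rewrite mulr_ge0// ltW.
apply: (@le_trans _ _ (\sum_(i < N) h ^+ 2)).
  apply: ler_sum => i _; rewrite !mxE -real_normK ?num_real//.
  by rewrite lerXn2r ?nnegrE ?(ltW h0).
have -> : (N%:R * h) ^+ 2 = N%:R ^+ 2 * h ^+ 2 by rewrite exprMn.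
rewrite sumr_const card_ord -[_ *+ N]mulr_natl; apply: ler_wpM2r; first exact: sqr_ge0.
by rewrite -natrX ler_nat; case: (N) => // n; rewrite leq_pmulr.
Qed.

Variables (I : finType) (cell : 'rV[R]_N -> I).

Definition adjacent K (s : R) : rel I := fun i j =>
  `[< exists x y, [/\ K x, K y, cell x = i, cell y = j & enorm (x - y) < s] >].

(** The points whose cell is reached from that of [x] form a subset of [K] at
    distance at least [s] from the rest of [K]; it is therefore relatively open
    and closed. *)
Lemma connected_adjacent K (s : R) x y : 0 < s -> connected K -> K x -> K y ->
  connect (adjacent K s) (cell x) (cell y).
Proof.
move=> s0 cK Kx Ky; pose A := [set z | K z /\ connect (adjacent K s) (cell x) (cell z)].
suff : A = K by move=> AK; have : A y by [rewrite AK]; case.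
have ball_self z : eball z s z by rewrite /eball/= subrr enorm0.
have step z t : A z -> K t -> enorm (z - t) < s -> A t.
  move=> [Kz xz] Kt zt; split => //; apply: connect_trans xz _; apply: connect1.
  by apply/asboolP; exists z, t.
apply: cK; first by exists x; split => //; exact: connect0.
- exists (\bigcup_(z in A) eball z s); first by apply: bigcup_open => z _; exact: open_eball.
  apply/seteqP; split => t; first by move=> At; split; [case: At|exists t].
  by move=> [Kt [z Az zt]]; exact: step Az Kt zt.
- exists (~` \bigcup_(z in K `\` A) eball z s).
    by apply: open_closedC; apply: bigcup_open => z _; exact: open_eball.
  apply/seteqP; split => t.
    move=> At; split; first by case: At.
    by move=> [z [Kz nAz] zt]; apply: nAz; apply: step At Kz _; rewrite enorm_dC.
  by move=> [Kt H]; apply: contrapT => nAt; apply: H; exists t.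
Qed.

End chains.

Section chain_estimate.
Context {R : realType} {N : nat}.
Local Notation mu := (@lebesgue_rV R N).

Lemma lebesgue_eball_shift (c : 'rV[R]_N) (s : R) : mu (eball c s) = mu (eball 0 s).
Proof.
have mb (z : 'rV[R]_N) : measurable (eball z s) by apply: measurable_open; exact: open_eball.
have E z : mu (eball z s) = (\int[mu]_x (\1_(eball z s) x)%:E)%E.
  by rewrite integral_indic// setIT.
rewrite !E -(integral_translation c (f := fun x => (\1_(eball c s) x)%:E)).
- apply: eq_integral => x _; congr EFin; rewrite !indicE; congr (nat_of_bool _)%:R.
  by rewrite -[LHS]/(`[< _ >]) -[RHS]/(`[< _ >]) /eball/= opprD addrCA subrr addr0 sub0r.
- by apply/measurable_EFinP; exact: measurable_indic.
- by move=> x; rewrite lee_fin.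
Qed.

Variables (p r C1 V : R) (K : set 'rV[R]_N) (u : 'rV[R]_N -> R) (E : \bar R).
Hypothesis (p1 : 1 < p) (r0 : 0 < r) (C10 : 0 <= C1) (V0 : 0 < V) (E0 : (0 <= E)%E).
Hypothesis mfu : measurable_fun setT u.
Let Om := \bigcup_(y in K) eball y r.
Hypothesis OmV : (mu Om <= V%:E)%E.
(* The local estimate is kept abstract: only the resulting bound on oscillations
   matters for the chains. *)
Hypothesis loc : forall A B, measurable A -> measurable B -> A `<=` Om -> B `<=` Om ->
  (forall x z, A x -> B z -> exists2 y, K y & eball y r x /\ eball y r z) ->
  (osc p u A B <= C1%:E * E)%E.

Let beta := fine (mu (eball (0 : 'rV[R]_N) (r / 2))).

Let ball (c : 'rV[R]_N) := eball c (r / 2).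

Let mball c : measurable (ball c).
Proof. by apply: measurable_open; exact: open_eball. Qed.

Let r2 : 0 < r / 2. Proof. by rewrite divr_gt0. Qed.

Let r2r : r / 2 < r. Proof. by rewrite ltr_pdivrMr// ltr_pMr// ltr1n. Qed.

Let mu_ball c : mu (ball c) = beta%:E.
Proof.
rewrite /ball lebesgue_eball_shift /beta fineK// ge0_fin_numE//.
by apply: le_lt_trans (lebesgue_eball_le _ r2) _; rewrite ltry.
Qed.

Let beta0 : 0 < beta.
Proof. by rewrite -lte_fin -(mu_ball 0); exact: lebesgue_eball_gt0. Qed.

Let mOm : measurable Om.
Proof. by apply: measurable_open; apply: bigcup_open => y _; exact: open_eball. Qed.

Let eball_Om y : K y -> eball y r `<=` Om.
Proof. by move=> Ky x yx; exists y. Qed.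

Let ball_Om y : K y -> ball y `<=` Om.
Proof.
move=> Ky; apply: subset_trans (eball_Om Ky) => x; rewrite /ball /eball/= => h.
exact: lt_trans h r2r.
Qed.

Let mu_le A : measurable A -> A `<=` Om -> (mu A <= V%:E)%E.
Proof. by move=> mA AOm; apply: le_trans OmV; apply: le_measure => //; rewrite inE. Qed.

(** An intermediate ball of measure [beta] costs a factor that depends on neither
    [A], nor [C], nor [K]. *)
Let osc_through c A C (a b : R) : K c -> measurable A -> measurable C -> A `<=` Om -> C `<=` Om ->
  0 <= a -> 0 <= b -> (osc p u A (ball c) <= a%:E * E)%E -> (osc p u (ball c) C <= b%:E * E)%E ->
  (osc p u A C <= (2 `^ p * V / beta * (a + b))%:E * E)%E.
Proof.
move=> Kc mA mC AOm COm a0 b0 HA HC.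
have := osc_triangle (lt_trans ltr01 p1) mfu mA (mball c) mC.
rewrite mu_ball => H.
have H2 : (osc p u A C * beta%:E <= (2 `^ p * V * (a + b))%:E * E)%E.
  apply: le_trans H _; rewrite -mulrA EFinM -muleA; apply: lee_wpmul2l; first by rewrite lee_fin powR_ge0.
  apply: (@le_trans _ _ ((a%:E * E) * V%:E + (b%:E * E) * V%:E)%E).
    by apply: leeD; apply: lee_pmul => //; rewrite ?osc_ge0//; apply: mu_le.
  by rewrite -ge0_muleDl ?mule_ge0 ?lee_fin// -ge0_muleDl ?lee_fin// muleC muleA.
rewrite [X in X%:E](_ : _ = (2 `^ p * V * (a + b)) * beta^-1); last by field; rewrite gt_eqF.
by rewrite [X in (X * _)%E]EFinM muleAC lee_pdivlMr.
Qed.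

Let kappa := 2 `^ p * V / beta.

Let kappa0 : 0 <= kappa.
Proof. by rewrite divr_ge0 ?(ltW beta0)// mulr_ge0 ?powR_ge0 ?ltW. Qed.

(** The constant obtained after [k] links of a chain of balls. *)
Fixpoint chain_const (k : nat) : R :=
  if k is k.+1 then C1 + kappa * (chain_const k + C1) else C1.

Lemma chain_const_ge0 k : 0 <= chain_const k.
Proof. by elim: k => [|k IHk] //=; rewrite addr_ge0// mulr_ge0// addr_ge0. Qed.

Lemma le_chain_const k l : (k <= l)%N -> chain_const k <= chain_const l.
Proof.
have step m : chain_const m <= chain_const m.+1.
  elim: m => [|m IHm] /=; first by rewrite lerDl mulr_ge0// addr_ge0.
  by rewrite lerD2l ler_wpM2l// lerD2r.
by move=> /subnKC <-; elim: (l - k)%N => [|m IHm]; rewrite ?addn0// addnS (le_trans IHm).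
Qed.

Variables (I : finType) (cell : 'rV[R]_N -> I).
Hypothesis cK : connected K.
Hypothesis cellK : forall x y, K x -> K y -> cell x = cell y -> enorm (x - y) < r / 8.

Let osc_near c c' : K c -> K c' -> enorm (c - c') < r / 2 ->
  (osc p u (ball c) (ball c') <= C1%:E * E)%E.
Proof.
move=> Kc Kc' cc'; apply: loc => //; [exact: ball_Om|exact: ball_Om|].
move=> x z cx cz; exists c => //; split; first exact: lt_trans cx r2r.
by apply: le_lt_trans (enorm_dist c c' z) _; rewrite /ball /eball/= in cz; lra.
Qed.

Let osc_path (q : seq I) (x y : 'rV[R]_N) : path (adjacent cell K (r / 8)) (cell x) q ->
  K x -> K y -> last (cell x) q = cell y ->
  (osc p u (ball x) (ball y) <= (chain_const (size q))%:E * E)%E.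
Proof.
elim: q x => [|i q IHq] x /=.
  move=> _ Kx Ky xy; apply: osc_near => //.
  by have h := cellK Kx Ky xy; have h0 := r0; lra.
move=> /andP[/asboolP[x' [z [Kx' Kz xx' zi x'z]]] iq] Kx Ky iy.
rewrite -zi in iq iy.
apply: le_trans (osc_through (c := z) (a := C1) (b := chain_const (size q)) Kz _ _ _ _ _ _ _ _) _ => //.
- exact: ball_Om.
- exact: ball_Om.
- exact: chain_const_ge0.
- apply: osc_near => //; apply: le_lt_trans (enorm_dist x x' z) _.
  by have h := cellK Kx Kx' (esym xx'); have h0 := r0; lra.
- exact: IHq.
apply: lee_wpmul2r => //; rewrite lee_fin -/kappa addrC.
by rewrite [X in _ * X]addrC lerDr.
Qed.

(** A path of cells without repetition has at most as many vertices as there are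
    cells. *)
Let osc_balls x y : K x -> K y -> (osc p u (ball x) (ball y) <= (chain_const #|I|)%:E * E)%E.
Proof.
move=> Kx Ky; have r8 : 0 < r / 8 by rewrite divr_gt0.
have /connectP[q qP] := connected_adjacent cell r8 cK Kx Ky.
case/shortenP : qP => q' q'P uq' _ yq'.
apply: le_trans (osc_path q'P Kx Ky (esym yq')) _.
apply: lee_wpmul2r => //; rewrite lee_fin le_chain_const//.
have := card_uniqP uq'; rewrite /= => H; have := max_card (mem (cell x :: q')).
by rewrite H => /ltnW.
Qed.

Definition tube_const : R :=
  kappa * (2 * (#|I|%:R * (kappa * (C1 + chain_const #|I|)))).

(** The tube is the union of the finitely many sets [D i], made of the balls whose
    centres lie in one cell.  Each is close to a ball around a point of [K], from
    where a chain leads to the ball around [c]; two copies of the tube are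
    compared through that ball. *)
Lemma osc_tube : K !=set0 -> (osc p u Om Om <= tube_const%:E * E)%E.
Proof.
move=> [c Kc]; set a := kappa * (C1 + chain_const #|I|).
have a0 : 0 <= a by rewrite mulr_ge0// addr_ge0// chain_const_ge0.
pose D (i : I) := \bigcup_(y in [set y | K y /\ cell y = i]) eball y r.
have mD i : measurable (D i).
  by apply: measurable_open; apply: bigcup_open => y _; exact: open_eball.
have DOm i : D i `<=` Om by move=> x [y [Ky _] yx]; exists y.
have OmD : Om = \bigcup_i D i.
  by apply/seteqP; split => x; [move=> [y Ky yx]; exists (cell y) => //; exists y|move=> [i _ /DOm]].
have HD i : (osc p u (D i) (ball c) <= a%:E * E)%E.
  have [[y [Ky yi]]|nD] := pselect (exists y, K y /\ cell y = i); last first.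
    rewrite (_ : D i = set0) ?/osc ?integral_set0 ?mule_ge0//.
    by apply/seteqP; split => // x [y Kyi _]; apply: nD; exists y.
  apply: (osc_through Ky) => //.
  - exact: ball_Om.
  - exact: chain_const_ge0.
  - apply: loc => //; first exact: ball_Om.
    move=> x z [y' [Ky' y'i] y'x] yz; exists y' => //; split => //.
    have yy' := cellK Ky' Ky; rewrite yi y'i in yy'.
    apply: le_lt_trans (enorm_dist y' y z) _.
    by have h := yy' erefl; have h0 := r0; rewrite /ball /eball/= in yz; lra.
  - exact: osc_balls.
have HOm : (osc p u Om (ball c) <= (#|I|%:R * a)%:E * E)%E.
  rewrite OmD; apply: le_trans (osc_bigcup p mfu mD (mball c)) _.
  apply: (@le_trans _ _ (\sum_(i : I) (a%:E * E))%E); first exact: lee_sum.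
  by rewrite -ge0_sume_distrl ?sumEFin ?sumr_const ?mulr_natl.
apply: le_trans (osc_through (c := c) (a := #|I|%:R * a) (b := #|I|%:R * a) Kc _ _ _ _ _ _ _ _) _ => //.
- by rewrite mulr_ge0.
- by rewrite mulr_ge0.
- by rewrite (oscC p mfu (mball c) mOm).
by rewrite -/kappa /tube_const -/a; apply: lee_wpmul2r => //; rewrite lee_fin mulr2n mulrDl mul1r.
Qed.

End chain_estimate.

(** * The Poincaré inequality on tubes *)

Section sobolev.
Context {R : realType} {N : nat}.
Local Notation mu := (@lebesgue_rV R N).

Lemma in_Lp_integrable (p : R) (Om : set 'rV[R]_N) (f : 'rV[R]_N -> R) : 1 < p ->
  measurable Om -> (mu Om < +oo)%E -> in_Lp p Om f -> mu.-integrable Om (EFin \o f).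
Proof.
move=> p1 mOm Omoo [mf foo]; apply/integrableP; split; first exact/measurable_EFinP.
have mfp : measurable_fun Om (fun x => (`|f x| `^ p)%:E).
  apply/measurable_EFinP; apply: (@measurableT_comp _ _ _ _ _ _ (@powR R ^~ p)).
    exact: measurable_powR.
  exact: measurableT_comp.
apply: (@le_lt_trans _ _ (\int[mu]_(x in Om) (1 + (`|f x| `^ p)%:E))%E).
  apply: ge0_le_integral => //.
  - by apply/measurable_EFinP; exact: measurableT_comp.
  - exact: emeasurable_funD.
  move=> x _; rewrite /= -EFinD lee_fin.
  have [f1|f1] := leP `|f x| 1; first by apply: le_trans f1 _; rewrite lerDl powR_ge0.
  rewrite -[leLHS](powRr1 (normr_ge0 _)); apply: (@le_trans _ _ (`|f x| `^ p)); last by rewrite lerDr.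
  by apply: ler_powR; exact: ltW.
rewrite ge0_integralD//.
by rewrite integral_cst// mul1e lte_add_pinfty.
Qed.

Lemma Rintegral_patchM (Om : set 'rV[R]_N) (f h : 'rV[R]_N -> R) :
  \int[mu]_(x in Om) (f x * h x) = \int[mu]_x ((f \_ Om) x * h x).
Proof.
rewrite Rintegral_mkcond; apply: eq_Rintegral => x _; rewrite !patchE.
by case: (x \in Om) => //; exact/esym/mul0r.
Qed.

Lemma weak_partial_bump (Om : set 'rV[R]_N) i (u v : 'rV[R]_N -> R) : weak_partial Om i u v ->
  forall k a b, cbox a b `<=` Om ->
  \int[mu]_x ((u \_ Om) x * partial i (tbump k a b) x) = - \int[mu]_x ((v \_ Om) x * tbump k a b x).
Proof.
move=> wuv k a b abOm.
rewrite -(Rintegral_patchM Om u (partial i (tbump k a b))) -(Rintegral_patchM Om v (tbump k a b)).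
by rewrite /Rintegral (wuv _ (test_function_tbump k abOm)) fineN.
Qed.

Lemma integrable_patch (Om : set 'rV[R]_N) (f : 'rV[R]_N -> R) : measurable Om ->
  mu.-integrable Om (EFin \o f) -> mu.-integrable setT (EFin \o (f \_ Om)).
Proof. by move=> mOm fi; rewrite -restrict_EFin; exact: (integrable_mkcond _ mOm).1. Qed.

Lemma integrable_restr (Om : set 'rV[R]_N) (f : 'rV[R]_N -> R) : measurable Om ->
  mu.-integrable setT (EFin \o f) -> mu.-integrable Om (EFin \o f).
Proof. by move=> mOm; apply: integrableS. Qed.

Lemma norm_sum_le (d v : 'rV[R]_N) (L : R) : enorm d <= L ->
  `|\sum_(i < N) d 0 i * v 0 i| <= N%:R * L * enorm v.
Proof.
move=> dL; apply: le_trans (ler_norm_sum _ _ _) _.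
apply: (@le_trans _ _ (\sum_(i < N) (L * enorm v))).
  apply: ler_sum => i _; rewrite normrM; apply: ler_pM => //.
    exact: le_trans (coord_le_enorm d i) dL.
  exact: coord_le_enorm.
by rewrite sumr_const card_ord -mulrA mulr_natl.
Qed.

Variables (p r : R) (K : set 'rV[R]_N) (u : 'rV[R]_N -> R) (v : 'rV[R]_N -> 'rV[R]_N).
Hypothesis (p1 : 1 < p) (r0 : 0 < r).
Let Om := \bigcup_(y in K) eball y r.
Hypothesis ui : mu.-integrable setT (EFin \o u).
Hypothesis vi : forall i, mu.-integrable setT (EFin \o (fun x => v x 0 i)).
Hypothesis wD : forall k a b i, cbox a b `<=` Om ->
  \int[mu]_x (u x * partial i (tbump k a b) x) = - \int[mu]_x (v x 0 i * tbump k a b x).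

Let e x : \bar R := (enorm (v x) `^ p)%:E.

Let M := (N%:R * (2 * r)) `^ p.

Lemma measurable_enorm_powR : measurable_fun setT e.
Proof.
apply/measurable_EFinP; apply: (@measurableT_comp _ _ _ _ _ _ (@powR R ^~ p)).
  exact: measurable_powR.
apply: (@measurableT_comp _ _ _ _ _ _ (@enorm R N)).
  by apply: continuous_measurable_rV; exact: enorm_continuous.
by apply: measurable_fun_rV => i; exact: measurable_integrable (vi i).
Qed.

(** The local Poincaré inequality: any [x] in [A] and [z] in [B] lie in a common
    ball centred in [K], hence are joined by a segment inside the tube.  Along it
    [u x - u z] is the average of the gradient against [z - x], and the average
    over all segments costs a bounded factor. *)
Lemma local_osc A B (V : R) : measurable A -> measurable B -> (mu A <= V%:E)%E -> (mu B <= V%:E)%E ->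
  (forall x z, A x -> B z -> exists2 y, K y & eball y r x /\ eball y r z) ->
  (osc p u A B <= (M * (2 ^+ N * (2 * V)))%:E * \int[mu]_x e x)%E.
Proof.
move=> mA mB AV BV AB.
have e0 x : (0 <= e x)%E by rewrite lee_fin powR_ge0.
have p0 : 0 < p by exact: lt_trans p1.
have M0 : 0 <= M by exact: powR_ge0.
have mmu := measurable_integrable ui.
apply: (@le_trans _ _ (M%:E * ((2 ^+ N)%:E * (mu A + mu B) * \int[mu]_x e x))%E); last first.
  have -> : ((M * (2 ^+ N * (2 * V)))%:E * \int[mu]_x e x =
      M%:E * ((2 ^+ N)%:E * (V%:E + V%:E) * \int[mu]_x e x))%E.
    by rewrite -EFinD -EFinM muleA -EFinM mulrDl mul1r.
  apply: lee_wpmul2l; first by rewrite lee_fin.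
  apply: lee_wpmul2r; first exact: integral_ge0.
  apply: lee_wpmul2l; first by rewrite lee_fin exprn_ge0.
  exact: leeD.
apply: (integral_pairs_le measurable_enorm_powR e0 mA mB M0 (measurable_gap p mmu) (gap_ge0 p u)) => d.
pose w x := \sum_(i < N) d 0 i * v x 0 i.
have wi : mu.-integrable setT (EFin \o w) by apply: integrable_sumZ.
(* The starting points whose segment of direction [d] stays in one ball. *)
pose O := \bigcup_(y in K) (eball y r `&` [set x | eball y r (x + d)]).
have oO : open O.
  apply: bigcup_open => y _; apply: openI; first exact: open_eball.
  rewrite [X in open X](_ : _ = eball (y - d) r); first exact: open_eball.
  by apply/seteqP; split=> x; rewrite /eball/= opprD addrA (addrAC y).
have segO x (s : R) : O x -> 0 <= s <= 1 -> Om (x + s *: d).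
  move=> [y Ky [yx yxd]] s01; exists y => //.
  by have := eball_convex s01 yx yxd; rewrite (addrC x d) addrK.
have H1 := weak_line ui vi wD oO segO.
have H2 := ae_integrable1 (integrable_line d wi).
apply: filterS2 H1 H2 => x Hx xi Ax Bxd.
have [y Ky [yx yxd]] := AB _ _ Ax Bxd.
have d2r : enorm d <= 2 * r.
  have -> : d = (x + d - y) - (x - y) by rewrite opprB addrA subrK addrC addKr.
  apply: le_trans (enorm_triangle _ _) _; rewrite enormN (enorm_dC _ y) (enorm_dC x).
  by rewrite /eball/= in yx yxd; lra.
have Ox : O x by exists y.
rewrite /gap distrC (Hx Ox).
have := @jensen_powR _ _ _ unif setT (fun s => w (x + s *: d)) p 1 p1 measurableT unifT ltr01 xi.
rewrite mul1r divr1 => /le_trans; apply.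
have ml : measurable_fun setT (fun s : measurableTypeR R => x + s *: d).
  exact: (measurableT_comp (measurable_line d) (pair1_measurable x)).
rewrite -ge0_integralZl//; last exact: (measurableT_comp measurable_enorm_powR ml).
apply: ge0_le_integral => //.
- apply/measurable_EFinP; apply: (@measurableT_comp _ _ _ _ _ _ (@powR R ^~ p)).
    exact: measurable_powR.
  by apply: measurableT_comp => //; exact: (measurableT_comp (measurable_integrable wi) ml).
- by apply: measurable_funeM; exact: (measurableT_comp measurable_enorm_powR ml).
move=> s _; rewrite /e -EFinM lee_fin -powRM ?enorm_ge0 ?mulr_ge0 ?(ltW r0)//.
apply: ge0_ler_powR; rewrite ?nnegrE ?mulr_ge0 ?enorm_ge0 ?(ltW r0) ?(ltW p0)//.
exact: norm_sum_le.
Qed.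

End sobolev.

Section mean_zero.
Context {R : realType} {N : nat}.
Local Notation mu := (@lebesgue_rV R N).

(** A function of mean zero is, at each point, the mean of its differences with
    the other values; Jensen's inequality applies to this mean. *)
Lemma mean_zero_osc (p : R) (Om : set 'rV[R]_N) (u : 'rV[R]_N -> R) (m : R) : 1 < p ->
  measurable Om -> mu Om = m%:E -> 0 < m -> measurable_fun setT u ->
  mu.-integrable Om (EFin \o u) -> (\int[mu]_(x in Om) (u x)%:E = 0)%E ->
  (m%:E * \int[mu]_(x in Om) (`|u x| `^ p)%:E <= osc p u Om Om)%E.
Proof.
move=> p1 mOm Omm m0 mmu ui u0.
have p0 : 0 < p by exact: lt_trans p1.
have mup : measurable_fun Om (fun x => (`|u x| `^ p)%:E).
  apply/measurable_EFinP; apply: (@measurableT_comp _ _ _ _ _ _ (@powR R ^~ p)).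
    exact: measurable_powR.
  by apply: measurableT_comp => //; exact: measurable_funTS.
rewrite -ge0_integralZl//; last by rewrite lee_fin ltW.
apply: ge0_le_integral => //.
- by move=> x _; rewrite -EFinM lee_fin mulr_ge0 ?powR_ge0// ltW.
- exact: measurable_funeM.
- exact: measurable_int_gap1.
move=> x _.
have ci : mu.-integrable Om (EFin \o (fun=> u x)).
  apply/integrableP; split; first exact: measurable_cst.
  have -> : (\int[mu]_(z in Om) `|(EFin \o (fun=> u x)) z| = `|u x|%:E * m%:E)%E.
    by rewrite -Omm; exact: (integral_cst mu mOm).
  by rewrite -EFinM ltry.
have di : mu.-integrable Om (EFin \o (fun z => u x - u z)) by exact: (integrableB mOm ci ui).
have := jensen_powR p1 mOm Omm m0 di; apply: le_trans.
have cst_int : \int[mu]_(z in Om) (fun=> u x) z = u x * m.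
  by rewrite (Rintegral_cst mu mOm) [X in fine X](Omm : _ = m%:E).
rewrite (RintegralB mOm ci ui) cst_int (_ : \int[mu]_(z in Om) u z = 0); last first.
  by rewrite /Rintegral u0.
by rewrite subr0 normrM (gtr0_norm m0) mulfK ?gt_eqF// EFinM.
Qed.

End mean_zero.

Theorem corollary1p3 (R : realType) (N : nat) (p rho r : R) :
  1 < p -> 0 < rho -> 0 < r ->
  exists C : R, 0 < C /\
    forall K : set 'rV[R]_N,
      K !=set0 -> connected K -> K `<=` eball 0 rho ->
      forall (u : 'rV[R]_N -> R) (Du : 'rV[R]_N -> 'rV[R]_N),
        W1p_gradient p (tube K r) u Du ->
        (\int[lebesgue_rV N]_(x in tube K r) (u x)%:E = 0)%E ->
        (\int[lebesgue_rV N]_(x in tube K r) (`|u x| `^ p)%:E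
         <= C%:E * \int[lebesgue_rV N]_(x in tube K r) (enorm (Du x) `^ p)%:E)%E.
Proof.
move=> p1 rho0 r0.
have p0 : 0 < p by exact: lt_trans p1.
have r80 : 0 < r / 8 by rewrite divr_gt0.
have r20 : 0 < r / 2 by rewrite divr_gt0.
have rr0 : 0 < rho + r by rewrite addr_gt0.
(* The grid, the bounds on the measure of the tube and thus the constant are all
   chosen before the set [K]. *)
have [I [cell cellP]] := @grid_cells R N rho (r / 8) rho0 r80.
pose mu := @lebesgue_rV R N.
pose V : R := (2 * (rho + r)) ^+ N.
have V0 : 0 < V by rewrite exprn_gt0// mulr_gt0.
pose C1 : R := (N%:R * (2 * r)) `^ p * (2 ^+ N * (2 * V)).
have C10 : 0 <= C1 by rewrite /C1 mulr_ge0 ?powR_ge0// mulr_ge0 ?exprn_ge0// mulr_ge0// ltW.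
pose beta := fine (mu (eball 0 (r / 2))).
have muB : mu (eball 0 (r / 2)) = beta%:E.
  rewrite /beta fineK// ge0_fin_numE//.
  by apply: le_lt_trans (lebesgue_eball_le _ r20) _; rewrite ltry.
have beta0 : 0 < beta by rewrite -lte_fin -muB; exact: lebesgue_eball_gt0.
pose C2 := @tube_const R N p r C1 V I.
(* The summand 1 and the absolute value only ensure positivity. *)
exists (`|C2| / beta + 1); split; first by rewrite ltr_wpDl// divr_ge0// ltW.
move=> K K0 cK Krho u Du [uLp DuLp wD] u0.
rewrite (tubeE _ K0) in uLp DuLp wD u0 *.
set Om := \bigcup_(y in K) eball y r in uLp DuLp wD u0 *.
have mOm : measurable Om.
  by apply: measurable_open; apply: bigcup_open => y _; exact: open_eball.
have mball (c : 'rV[R]_N) s : measurable (eball c s) by apply: measurable_open; exact: open_eball.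
have OmV : (mu Om <= V%:E)%E.
  apply: le_trans (lebesgue_eball_le 0 rr0); apply: le_measure; rewrite ?inE//.
  move=> x [y Ky yx]; apply: le_lt_trans (enorm_dist 0 y x) _.
  by apply: ltrD => //; exact: Krho.
have OmE : mu Om = (fine (mu Om))%:E.
  by rewrite fineK// ge0_fin_numE//; apply: le_lt_trans OmV _; rewrite ltry.
have Omoo : (mu Om < +oo)%E by rewrite OmE ltry.
have betaOm : beta <= fine (mu Om).
  have [c Kc] := K0; rewrite -lee_fin -OmE -muB -(lebesgue_eball_shift c).
  apply: le_measure; rewrite ?inE// => x cx; exists c => //.
  by apply: lt_trans cx _; rewrite ltr_pdivrMr// ltr_pMr// ltr1n.
have Om0 : 0 < fine (mu Om) by exact: lt_le_trans betaOm.
have uiOm : mu.-integrable Om (EFin \o u) by exact: in_Lp_integrable uLp.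
(* Extended by zero, [u] and its gradient are integrable on the whole space. *)
pose u1 := u \_ Om.
pose v1 (x : 'rV[R]_N) : 'rV[R]_N := \row_i ((fun x => Du x 0 i) \_ Om) x.
have ui : mu.-integrable setT (EFin \o u1) by exact: integrable_patch.
have v1E i : (fun x => v1 x 0 i) = (fun x => Du x 0 i) \_ Om by apply/funext => x; rewrite mxE.
have vi i : mu.-integrable setT (EFin \o (fun x => v1 x 0 i)).
  by rewrite v1E; apply: integrable_patch => //; apply: in_Lp_integrable (DuLp i).
have mu1 := measurable_integrable ui.
have u1E x : Om x -> u1 x = u x by move=> Omx; rewrite /u1 patchE mem_set.
pose E := (\int[mu]_x (enorm (v1 x) `^ p)%:E)%E.
have EE : (\int[mu]_(x in Om) (enorm (Du x) `^ p)%:E)%E = E.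
  rewrite integral_mkcond; apply: eq_integral => x _; rewrite patchE.
  case: ifPn => xOm.
    by congr ((enorm _) `^ p)%:E; apply/rowP => i; rewrite mxE patchE xOm.
  rewrite (_ : v1 x = 0) ?enorm0 ?powR0 ?gt_eqF//.
  by apply/rowP => i; rewrite !mxE patchE (negbTE xOm).
have E0 : (0 <= E)%E by apply: integral_ge0 => x _; rewrite lee_fin powR_ge0.
have wD1 k a b i : cbox a b `<=` Om ->
    \int[mu]_x (u1 x * partial i (tbump k a b) x) = - \int[mu]_x (v1 x 0 i * tbump k a b x).
  move=> abOm; rewrite (weak_partial_bump (wD i) k abOm); congr (- _).
  by apply: eq_Rintegral => x _; rewrite mxE.
have Hosc : (osc p u1 Om Om <= C2%:E * E)%E.
  apply: (osc_tube p1 r0 C10 V0 E0 mu1 OmV _ cK (cell := cell) _ K0) => [A B mA mB AOm BOm AB|x y Kx Ky].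
    apply: (local_osc p1 r0 ui vi wD1 mA mB _ _ AB).
      by apply: le_trans OmV; apply: le_measure; rewrite ?inE.
    by apply: le_trans OmV; apply: le_measure; rewrite ?inE.
  by apply: cellP; exact: Krho.
clearbody E.
have u1i : mu.-integrable Om (EFin \o u1) by exact: integrable_restr.
have u10 : (\int[mu]_(x in Om) (u1 x)%:E = 0)%E.
  by rewrite -u0; apply: eq_integral => x; rewrite inE => /u1E ->.
have := mean_zero_osc p1 mOm OmE Om0 mu1 u1i u10.
rewrite (eq_integral (fun x => (`|u x| `^ p)%:E)); last first.
  by move=> x; rewrite inE => /u1E ->.
rewrite EE.
clearbody C1 C2 beta V.
set J := (\int[_]_(x in _) _)%E => H.
have J0 : (0 <= J)%E.
  by apply: integral_ge0 => x _; rewrite lee_fin powR_ge0.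
have H2 : (beta%:E * J <= `|C2|%:E * E)%E.
  apply: (@le_trans _ _ ((fine (mu Om))%:E * J)%E).
    by apply: lee_wpmul2r.
  have C2E : (C2%:E * E <= `|C2|%:E * E)%E by apply: lee_wpmul2r => //; rewrite lee_fin ler_norm.
  exact: le_trans (le_trans H Hosc) C2E.
apply: (@le_trans _ _ ((`|C2| / beta)%:E * E)%E); last first.
  by apply: lee_wpmul2r => //; rewrite lee_fin lerDl.
by rewrite EFinM muleAC lee_pdivlMr// muleC.
Qed.
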